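(* Let $k\ge 1$ and let $g$ be a $k$-times differentiable (respectively, $k$-times continuously differentiable) real function defined on an interval $I$. Let $X$ be an $n\times n$ real symmetric matrix with all eigenvalues in $I$, and let $V$ be an orthogonal matrix such that $X=V(\mathrm{Diag}\,\lambda(X))V^T$. Then the matrix valued function $G$ associated with $g$ is $k$-times differentiable (respectively, $k$-times continuously differentiable) at $X$, and its $k$-th derivative is $$\nabla^kG(X)=V\Big(\sum_{\sigma\in\tilde P^{k+1}}\mathrm{Diag}^\sigma\,\mathbf{g}^{[\sigma]}(\lambda(X))\Big)V^T .$$
   Context: $S^n$ is the space of $n\times n$ real symmetric matrices, with $\langle X,Y\rangle=\mathrm{tr}(XY^T)$. For $X\in S^n$, $\lambda(X)$ is the vector of eigenvalues of $X$ in nonincreasing order. $\mathrm{Diag}\,x$ is the diagonal matrix with diagonal $x$. The function $G$: for a symmetric $X$ with eigenvalues in $I$ and an orthogonal $V$ with $X=V(\mathrm{Diag}\,\lambda(X))V^T$, $G(X)=V\,\mathrm{Diag}\big(g(\lambda_1(X)),\dots,g(\lambda_n(X))\big)V^T$ (this does not depend on the choice of $V$). $T^{k,n}$ is the space of $k$-tensors on $\mathbb{R}^n$ (multilinear maps $(\mathbb{R}^n)^k\to\mathbb{R}$), with entries $T^{i_1\dots i_k}$. For $T\in T^{k,n}$ and a permutation $\sigma$ of $\{1,\dots,k\}$, $\mathrm{Diag}^\sigma T$ is the $2k$-tensor whose entry with upper indices $i_1,\dots,i_k$ and lower indices $j_1,\dots,j_k$ equals $T^{i_1\dots i_k}$ if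 $i_r=j_{\sigma(r)}$ for all $r$, and $0$ otherwise. A $2k$-tensor is viewed as a $k$-linear form on matrices by $T[H_1,\dots,H_k]=\sum T^{\substack{p_1\dots p_k\\ q_1\dots q_k}}H_1^{p_1q_1}\cdots H_k^{p_kq_k}$ (sum over all $p_r,q_r\in\{1,\dots,n\}$). For an $m$-tensor $T$ and orthogonal $V$, $(VTV^T)^{i_1\dots i_m}=\sum_{p_1,\dots,p_m}T^{p_1\dots p_m}V^{i_1p_1}\cdots V^{i_mp_m}$ (for $2k$-tensors it is applied to all $2k$ indices). The derivative $\nabla^kG(X)$, a $k$-linear map from $S^n$ to $S^n$, is identified with the $(k+1)$-linear form $\nabla^kG(X)[H_1,\dots,H_{k+1}]=\langle\nabla^kG(X)[H_1,\dots,H_k],H_{k+1}\rangle$ on $S^n$, and the formula is an equality of $(k+1)$-linear forms on $S^n$. $\tilde P^s$ is the set of permutations of $\{1,\dots,s\}$ having exactly one cycle (the $s$-cycles). For $\sigma\in\tilde P^s$, regarded also as a permutation of $\{1,\dots,s+1\}$ fixing $s+1$, and $l\in\{1,\dots,s\}$, put $\sigma_{(l)}=\sigma\tau_l\in\tilde P^{s+1}$, with $\tau_l$ the transposition $(l,s+1)$ (so $\sigma_{(l)}(l)=s+1$ and $\sigma_{(l)}(s+1)=\sigma(l)$). Each element of $\tilde P^{s+1}$ equals $\sigma_{(l)}$ for exactly one pair $(\sigma,l)\in\tilde P^s\times\{1,\dots,s\}$. Functions $g^{[\sigma]}:I^s\to\mathbb{R}$, $\sigma\in\tilde P^s$, $2\le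 s\le k+1$, are defined recursively: $g^{[(12)]}(x,y)=\frac{g(x)-g(y)}{x-y}$ if $x\ne y$ and $g^{[(12)]}(x,x)=g'(x)$; and for $\sigma\in\tilde P^s$, $l\in\{1,\dots,s\}$, $$g^{[\sigma_{(l)}]}(x_1,\dots,x_{s+1})=\begin{cases}\nabla_l\,g^{[\sigma]}(x_1,\dots,x_s),& x_l=x_{s+1},\\ \dfrac{g^{[\sigma]}(x_1,\dots,x_l,\dots,x_s)-g^{[\sigma]}(x_1,\dots,x_{s+1},\dots,x_s)}{x_l-x_{s+1}},& x_l\ne x_{s+1},\end{cases}$$ where in the second case $x_l$ and $x_{s+1}$ both stand in position $l$, and $\nabla_l$ is the partial derivative in the $l$-th argument. For $\sigma\in\tilde P^s$ the $s$-tensor valued map $\mathbf{g}^{[\sigma]}$ is given for $\mu\in I^n$ by $\big(\mathbf{g}^{[\sigma]}(\mu)\big)^{i_1\dots i_s}=g^{[\sigma]}(\mu_{i_1},\dots,\mu_{i_s})$. *)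

(* Defs.v *)
From HB Require Import structures.
From mathcomp Require Import all_boot all_order all_fingroup all_algebra.
From mathcomp Require Import all_classical all_reals all_analysis.

Set Implicit Arguments.
Unset Strict Implicit.
Unset Printing Implicit Defensive.
Set Warnings "-redundant-canonical-projection".

Import Order.TTheory GRing.Theory Num.Theory numFieldNormedType.Exports.

Local Open Scope classical_set_scope.
Local Open Scope ring_scope.

Definition snoc (T : Type) j (h : 'I_j -> T) (v : T) : 'I_j.+1 -> T :=
  fun i => if unlift ord_max i is Some i' then h i' else v.

Definition upd (T : Type) j (h : 'I_j -> T) (i : 'I_j) (u : T) : 'I_j -> T :=
  fun r => if r == i then u else h r.

(* One-variable derivatives relative to I: at an endpoint belonging to I they
   are one-sided, at an interior point they are the usual derivatives. *)
Section OneVariable.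
Variable R : realType.
Implicit Types (I : set R) (f g : R -> R).

Definition diff_quot f (a t : R) : R := (f t - f a) / (t - a).

Definition derivable_on I f : Prop :=
  forall a, I a -> cvg (diff_quot f a @ within I a^').

Definition derive_on I f (a : R) : R := lim (diff_quot f a @ within I a^').

Definition times_differentiable_on I (k : nat) g : Prop :=
  forall j, (j < k)%N -> derivable_on I (iter j (derive_on I) g).

Definition times_cont_differentiable_on I (k : nat) g : Prop :=
  times_differentiable_on I k g /\
  {within I, continuous (iter k (derive_on I) g)}.

End OneVariable.

(* Iterated Frechet derivatives of f : V -> W at a point of a domain D, the
   increments being restricted to D; a j-th derivative is a bounded j-linear
   map, and j-linear maps are compared in the operator norm. *)
Section HigherDerivatives.
Variables (R : realType) (V W : normedModType R).
Implicit Types (D : set V) (f : V -> W) (x y : V).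

Definition multilinear j (A : ('I_j -> V) -> W) : Prop :=
  forall h i (a : R) u v,
    A (upd h i (a *: u + v)) = a *: A (upd h i u) + A (upd h i v).

Definition bounded_multilinear j (A : ('I_j -> V) -> W) : Prop :=
  multilinear A /\ exists M : R, forall h, `|A h| <= M * \prod_(i < j) `|h i|.

(* The new direction is the last argument of B. *)
Definition is_frechet_derivative D j (A : V -> ('I_j -> V) -> W) x
    (B : ('I_j.+1 -> V) -> W) : Prop :=
  bounded_multilinear B /\
  forall e : R, 0 < e -> \forall y \near within D (nbhs x), forall h : 'I_j -> V,
    `|A y h - A x h - B (snoc h (y - x))| <= e * `|y - x| * \prod_(i < j) `|h i|.

Fixpoint is_nabla D f (k : nat) x : (('I_k -> V) -> W) -> Prop :=
  match k return (('I_k -> V) -> W) -> Prop with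
  | 0 => fun L => forall h, L h = f x
  | j.+1 => fun L => exists A : V -> ('I_j -> V) -> W,
      (\forall y \near within D (nbhs x), is_nabla D f y (A y)) /\
      is_frechet_derivative D A x L
  end.

Definition continuous_at D j (A : V -> ('I_j -> V) -> W) x : Prop :=
  forall e : R, 0 < e -> \forall y \near within D (nbhs x), forall h : 'I_j -> V,
    `|A y h - A x h| <= e * \prod_(i < j) `|h i|.

Definition times_differentiable_at D (k : nat) f x : Prop :=
  exists L : ('I_k -> V) -> W, is_nabla D f x L.

Definition times_cont_differentiable_at D (k : nat) f x : Prop :=
  exists A : V -> ('I_k -> V) -> W,
    \forall y \near within D (nbhs x),
      is_nabla D f y (A y) /\ continuous_at D A y.

End HigherDerivatives.

Section SymmetricMatrices.
Variables (R : realType) (n : nat).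

Definition symmx : {pred 'M[R]_n} := fun A => A^T == A.

Lemma symmx_submod_closed : submod_closed symmx.
Proof.
split; first by rewrite unfold_in trmx0.
move=> a A B; rewrite !unfold_in => /eqP hA /eqP hB.
by rewrite linearP /= hA hB.
Qed.

HB.instance Definition _ :=
  GRing.isSubmodClosed.Build R 'M[R]_n symmx symmx_submod_closed.

Record sym := Sym { symval :> 'M[R]_n; _ : symval \in symmx }.

HB.instance Definition _ := [isSub for symval].
HB.instance Definition _ := [Choice of sym by <:].
HB.instance Definition _ := [SubChoice_isSubLmodule of sym by <:].

Definition sym_norm (A : sym) : R := `|symval A|.

Lemma sym_normD A B : sym_norm (A + B) <= sym_norm A + sym_norm B.
Proof. exact: ler_normD. Qed.

Lemma sym_normZ (a : R) A : sym_norm (a *: A) = `|a| * sym_norm A.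
Proof. exact: normrZ. Qed.

Lemma sym_norm_eq0 A : sym_norm A = 0 -> A = 0.
Proof. by move=> /eqP; rewrite normr_eq0 => /eqP A0; exact: val_inj. Qed.

HB.instance Definition _ :=
  Lmodule_isNormed.Build R sym sym_normD sym_normZ sym_norm_eq0.

End SymmetricMatrices.

Section SpectralFunctions.
Variables (R : realType) (n : nat).

Definition orthogonal_mx (V : 'M[R]_n) : Prop := V *m V^T = 1%:M.

Definition is_eigenvalue_vector (X : 'M[R]_n) (l : 'rV[R]_n) : Prop :=
  (forall i j : 'I_n, (i <= j)%N -> l 0 j <= l 0 i) /\
  char_poly X = \prod_(i < n) ('X - (l 0 i)%:P).

Definition lambda (X : 'M[R]_n) : 'rV[R]_n := xget 0 [set l | is_eigenvalue_vector X l].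

Definition is_diagonalizer (X V : 'M[R]_n) : Prop :=
  orthogonal_mx V /\ X = V *m diag_mx (lambda X) *m V^T.

Lemma conj_diag_sym (V : 'M[R]_n) (d : 'rV[R]_n) :
  V *m diag_mx d *m V^T \in @symmx R n.
Proof. by rewrite unfold_in !trmx_mul trmxK tr_diag_mx mulmxA. Qed.

Definition spectral_fun (g : R -> R) (X : sym R n) : sym R n :=
  let V := xget 1%:M [set V | is_diagonalizer X V] in
  Sym (conj_diag_sym V (map_mx g (lambda X))).

Definition spectral_dom (I : set R) : set (sym R n) :=
  [set X | forall i, I (lambda X 0 i)].

End SpectralFunctions.

Section Tensors.
Variables (R : realType) (n : nat).

Definition tensor (m : nat) := {ffun {ffun 'I_m -> 'I_n} -> R}.

(* In a 2k-tensor the k upper indices come first, then the k lower ones. *)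
Definition upper k (p : {ffun 'I_(k + k) -> 'I_n}) : {ffun 'I_k -> 'I_n} :=
  [ffun r => p (lshift k r)].

Definition lower k (p : {ffun 'I_(k + k) -> 'I_n}) : {ffun 'I_k -> 'I_n} :=
  [ffun r => p (rshift k r)].

Definition Diag k (s : 'S_k) (T : tensor k) : tensor (k + k) :=
  [ffun p => if [forall r, upper p r == lower p (s r)] then T (upper p) else 0].

Definition tensor_form k (T : tensor (k + k)) (H : 'I_k -> 'M[R]_n) : R :=
  \sum_(p : {ffun 'I_(k + k) -> 'I_n})
    T p * \prod_(r < k) H r (upper p r) (lower p r).

Definition tensor_conj m (V : 'M[R]_n) (T : tensor m) : tensor m :=
  [ffun i : {ffun 'I_m -> 'I_n} =>
    \sum_(p : {ffun 'I_m -> 'I_n}) T p * \prod_(r < m) V (i r) (p r)].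

End Tensors.

Section DividedDifferences.
Variables (R : realType) (I : set R) (g : R -> R).

Definition one_cycle s (t : 'S_s) : bool := #|porbits t| == 1%N.

(* sigma_(l); the product of permutations composes from left to right, so that
   l is sent to the new point ord_max, and ord_max to sigma(l). *)
Definition insert_cycle s (t : 'S_s) (l : 'I_s) : 'S_s.+1 :=
  (tperm (lift ord_max l) ord_max * lift_perm ord_max ord_max t)%g.

(* g^[sigma] for sigma a one-cycle permutation of s.+2 points; in the base case
   the only such permutation is (12), and values at other permutations are not
   used.  The pair picked below is the only one, by insert_cycle_inj. *)
Fixpoint div_diff (s : nat) : 'S_s.+2 -> ('I_s.+2 -> R) -> R :=
  match s return 'S_s.+2 -> ('I_s.+2 -> R) -> R with
  | 0 => fun _ x =>
      if x ord0 == x ord_max then derive_on I g (x ord0)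
      else (g (x ord0) - g (x ord_max)) / (x ord0 - x ord_max)
  | s'.+1 => fun t x =>
      if [pick p : 'S_s'.+2 * 'I_s'.+2 |
            one_cycle p.1 && (insert_cycle p.1 p.2 == t)] is Some (t', l) then
        let y := fun i => x (lift ord_max i) in
        let z := x ord_max in
        if y l == z then derive_on I (fun u => div_diff t' (upd y l u)) (y l)
        else (div_diff t' y - div_diff t' (upd y l z)) / (y l - z)
      else 0
  end.

Lemma insert_cycle_inj s (t t' : 'S_s) (l l' : 'I_s) :
  insert_cycle t l = insert_cycle t' l' -> t = t' /\ l = l'.
Proof.
move=> e.
have hl : insert_cycle t l (lift ord_max l) = ord_max.
  by rewrite permM tpermL lift_perm_id.
have hl' : insert_cycle t' l' (lift ord_max l') = ord_max.
  by rewrite permM tpermL lift_perm_id.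
have ll : l = l'.
  apply: (@lift_inj _ ord_max); apply: (@perm_inj _ (insert_cycle t l)).
  by rewrite hl e hl'.
split=> //; subst l'; move: e => /mulgI e.
by apply/permP => i; apply: (@lift_inj _ ord_max); rewrite -!(lift_perm_lift ord_max) e.
Qed.

Lemma div_diff_insert s (t : 'S_s.+2) (l : 'I_s.+2) (x : 'I_s.+3 -> R) :
  one_cycle t ->
  let y := fun i => x (lift ord_max i) in
  let z := x ord_max in
  div_diff (insert_cycle t l) x =
    if y l == z then derive_on I (fun u => div_diff t (upd y l u)) (y l)
    else (div_diff t y - div_diff t (upd y l z)) / (y l - z).
Proof.
move=> ct y z; rewrite [LHS]/=.
case: pickP => [[t' l'] /= /andP[_ /eqP /insert_cycle_inj[-> ->]] //|].
by move=> /(_ (t, l)); rewrite /= ct eqxx.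
Qed.

Definition div_diff_tensor n s (t : 'S_s.+2) (mu : 'rV[R]_n) : tensor R n s.+2 :=
  [ffun i : {ffun 'I_s.+2 -> 'I_n} => div_diff t (fun r => mu 0 (i r))].

End DividedDifferences.

(* Main.v *)
Require Import Defs.
From mathcomp Require Import all_boot all_order all_fingroup all_algebra.
From mathcomp Require Import all_classical all_reals all_analysis.
From mathcomp Require Import complex.
From mathcomp Require Import ring lra zify.

(** The proof compares [g] with polynomials.

    For a polynomial [p], expanding noncommutative products shows that the
    derivative of order [k] of [Y |-> p(Y)] at [X] in the directions
    [H_1, ..., H_k] is the sum, over all orderings of the directions, of a word
    [ncpoly] in which powers of [X] alternate with the directions; one more
    derivative inserts one more direction at every possible place
    ([ncpoly_taylor]).  In an eigenbasis of [X] the entries of such a word are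
    sums over paths of divided differences of [p] at the eigenvalues
    ([word_poly]).  Divided differences make sense for any sufficiently
    differentiable [g], and so does the resulting candidate [nabla] for the
    derivative of order [k].

    To differentiate the candidate of order [k] at [X], take a polynomial [p]
    that has the same derivatives as [g] up to order [k + 1] at the eigenvalues
    of [X].  Divided differences with at most [k + 2] points in the spectrum of
    [X] are the same for [g] and [p], so the candidates of order [k] and [k + 1]
    at [X] are those of [p].  The difference [f = g - p] is flat on the spectrum:
    its derivatives of order at most [k] are [o] of the distance to it.  Taking
    a difference quotient of a function costs one derivative and, by the mean
    value theorem, preserves such bounds ([tower_dq], [dq_jet_bound]), whence
    the divided differences of order [k] of [f] at points near the spectrum of
    [X] are small as well.  The eigenvalues of [Y] lie within a constant times
    [|Y - X|] of those of [X] ([spectrum_variation]), so that the candidate for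
    [f] at [Y] is [o] of [|Y - X|] ([nabla_word_taylor]).  Only the spectrum of
    [Y] enters these bounds, and the derivative of order [k + 1] of [g] enters
    only through its values on the spectrum of [X].  By induction on [k] the candidates are the derivatives ([nabla_is_nabla]);
    when the last derivative of [g] is continuous, the same splitting shows that
    the last candidate is continuous ([nabla_word_cont]).

    It remains to identify the formula.  Divided differences are iterated
    difference quotients; these commute ([dqC]), hence divided differences are
    symmetric in their points ([dd_perm]), and the recursion defining
    [g^[sigma]] computes them whatever the cycle [sigma] ([div_diff_dd]).
    Following a cycle of [k + 2] points from its last point lists the other
    [k + 1] ones in some order, which sets up a bijection with the orderings of
    the directions ([sum_one_cycle]), and contracting [Diag^sigma] along the
    cycle gives the trace of the corresponding word ([sum_cycle_relabel]). *)

Set Implicit Arguments.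
Unset Strict Implicit.
Unset Printing Implicit Defensive.

Import Order.TTheory GRing.Theory Num.Theory numFieldNormedType.Exports.

Local Open Scope classical_set_scope.
Local Open Scope ring_scope.

(** * Jets and their divided differences *)

Section Jets.
Variable K : numFieldType.
Implicit Types (F E : nat -> K -> K) (a b x : K) (s : seq K) (p q : {poly K}).

(** A jet [F] lists a function together with candidates [F 1], [F 2], ... for its
derivatives.  [dq a F] is the jet of [x |-> (F 0 x - F 0 a) / (x - a)]: away
from [a] its derivatives are forced by differentiating [(x - a) * f x] with
the Leibniz rule, at [a] their values are read off the Taylor expansion of
[F 0].  No limit occurs in it, so that the identities below are purely algebraic. *)
Fixpoint dq a F i x : K :=
  if x == a then F i.+1 a / i.+1%:R else
  if i is j.+1 then (F i x - i%:R * dq a F j x) / (x - a)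
  else (F 0 x - F 0 a) / (x - a).

Lemma dq_diag a F i : dq a F i a = F i.+1 a / i.+1%:R.
Proof. by case: i => [|i] /=; rewrite eqxx. Qed.

Lemma dq0E a F x : (x - a) * dq a F 0 x = F 0 x - F 0 a.
Proof.
rewrite /=; case: (eqVneq x a) => [->|xa]; first by rewrite !subrr mul0r.
by rewrite mulrC divfK // subr_eq0.
Qed.

Lemma dqSE a F i x :
  (x - a) * dq a F i.+1 x = F i.+1 x - i.+1%:R * dq a F i x.
Proof.
rewrite [dq a F i.+1 x]/=; case: (eqVneq x a) => [->|xa].
  by rewrite subrr mul0r dq_diag mulrC divfK ?subrr // pnatr_eq0.
by rewrite mulrC divfK // subr_eq0.
Qed.

(** The Leibniz recursion determines the jet away from [a], because [x - a] is
invertible there. *)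
Lemma dq_unique a F E :
  (forall x, (x - a) * E 0 x = F 0 x - F 0 a) ->
  (forall i x, (x - a) * E i.+1 x = F i.+1 x - i.+1%:R * E i x) ->
  (forall i, E i a = F i.+1 a / i.+1%:R) ->
  dq a F = E.
Proof.
move=> E0 ES Ea; apply/funext => i; apply/funext => x.
case: (eqVneq x a) => [->|xa]; first by rewrite dq_diag Ea.
have xa0 : x - a != 0 by rewrite subr_eq0.
by elim: i => [|i IH]; apply: (mulfI xa0); rewrite ?dq0E ?dqSE ?E0 ?ES ?IH.
Qed.


Lemma dq_swap a b F : dq a F 0 b = dq b F 0 a.
Proof.
rewrite /= eq_sym; case: eqVneq => [->//|ab].
by rewrite -(opprB b a) -[F 0 a - _]opprB invrN mulrNN.
Qed.

(** Commutation is what makes divided differences symmetric.  The induction also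
carries a companion identity, which is what remains to be compared once the
Leibniz recursion has been applied to both sides twice. *)
Lemma dqC a b F : dq a (dq b F) = dq b (dq a F).
Proof.
case: (eqVneq a b) => [->//|ab].
have ab0 : a - b != 0 by rewrite subr_eq0.
have ba0 : b - a != 0 by rewrite subr_eq0 eq_sym.
have nz i : i.+1%:R != 0 :> K by rewrite pnatr_eq0.
suff H : forall m, (forall x, dq a (dq b F) m x = dq b (dq a F) m x) /\
    (forall x, dq b F m x + (x - b) * dq b (dq a F) m x =
               dq a F m x + (x - a) * dq a (dq b F) m x).
  by apply/funext => i; apply/funext => x; case: (H i).
(* away from both points, two factors can be cancelled *)
have S1 m x : x != a -> x != b ->
    (x - b) * ((x - a) * dq a (dq b F) m x) =
    (x - b) * ((x - a) * dq b (dq a F) m x) ->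
    dq a (dq b F) m x = dq b (dq a F) m x.
  by move=> xa xb; rewrite !mulrA => /mulfI; apply; rewrite mulf_neq0 ?subr_eq0.
elim=> [|i [IH1 IH2]]; split=> x.
- case: (eqVneq x a) => [->|xa].
    by apply: (mulfI ab0); rewrite dq_diag dq0E divr1 dqSE !dq_diag dq_swap !divr1 mul1r.
  case: (eqVneq x b) => [->|xb].
    by apply: (mulfI ba0); rewrite dq_diag dq0E divr1 dqSE !dq_diag dq_swap !divr1 mul1r.
  apply: S1 => //; rewrite dq0E [in RHS]mulrCA dq0E (dq_swap a b) !mulrBr !dq0E.
  have -> : F 0 a = (a - b) * dq b F 0 a + F 0 b by rewrite dq0E subrK.
  by ring.
- by rewrite !dq0E (dq_swap a b) addrCA.
- case: (eqVneq x a) => [->|xa].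
    apply: (mulfI ab0); rewrite dq_diag dqSE -IH1 !dq_diag [LHS]mulrA dqSE.
    by field; rewrite nat1r -natrD !nz.
  case: (eqVneq x b) => [->|xb].
    apply: (mulfI ba0); rewrite dq_diag dqSE IH1 !dq_diag [RHS]mulrA dqSE.
    by field; rewrite nat1r -natrD !nz.
  apply: S1 => //; rewrite dqSE [in RHS]mulrCA dqSE !mulrBr !dqSE.
  by rewrite !IH1 !(mulrCA _ i.+1%:R) -!addrA -!opprD -!mulrDr -{1}IH1 IH1 IH2 IH1.
- by rewrite !dqSE IH1 addrCA.
Qed.

Lemma dq_linear a (c : K) F E :
  dq a (fun i x => c * F i x + E i x) =
  (fun i x => c * dq a F i x + dq a E i x).
Proof.
apply: dq_unique => [x|i x|i]; last by rewrite !dq_diag mulrDl mulrA.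
  by rewrite mulrDr mulrCA !dq0E; ring.
by rewrite mulrDr mulrCA !dqSE; ring.
Qed.

(** Agreement to order [m] at the points of [S] determines all divided
differences with at most [m] arguments, all in [S]; [dq_agree] is the step of
this induction. *)
Definition jets_agree m (S : set K) F E :=
  forall i x, (i < m)%N -> S x -> F i x = E i x.

Lemma dq_agree m S a F E :
  S a -> jets_agree m.+1 S F E -> jets_agree m S (dq a F) (dq a E).
Proof.
move=> Sa H i x; elim: i x => [|i IH] x im Sx /=; first by rewrite !H.
by rewrite H // (H i.+1 x) ?IH // ltnW // ltnW.
Qed.

(** Confluent divided difference, one point being consumed at a time. *)
Fixpoint dd F s : K :=
  if s is a :: s' then if s' is [::] then F 0 a else dd (dq a F) s' else 0.

(** All points but the last are consumed by difference quotients, and the last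
one is the variable: this displays a divided difference as a function of one
of its arguments. *)
Lemma dd_rcons F s a :
  dd F (rcons s a) = (foldl (fun E b => dq b E) F s) 0 a.
Proof.
elim: s F => [//|b s IH] F /=.
by case E: (rcons s a) => [|c s']; [case: (s) E | rewrite -E IH].
Qed.

Lemma foldl_dqC s a F :
  foldl (fun E b => dq b E) (dq a F) s = dq a (foldl (fun E b => dq b E) F s).
Proof. by elim: s F => [//|b s IH] F /=; rewrite dqC IH. Qed.

Lemma dd_cons_rcons F s a : dd F (a :: s) = dd F (rcons s a).
Proof.
case/lastP: s => [//|s b]; rewrite -rcons_cons !dd_rcons /=.
rewrite -cats1 foldl_cat /= foldl_dqC; exact: dq_swap.
Qed.

Lemma dd_rotate F s1 s2 : dd F (s1 ++ s2) = dd F (s2 ++ s1).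
Proof.
elim: s1 s2 F => [|a s1 IH] s2 F; first by rewrite cats0.
by rewrite cat_cons dd_cons_rcons -cats1 -catA IH -catA.
Qed.

(** Rotations are harmless because the last two points can be exchanged and
difference quotients commute; an arbitrary permutation first rotates the
head of one list to the front of the other. *)
Lemma dd_perm F s1 s2 : perm_eq s1 s2 -> dd F s1 = dd F s2.
Proof.
elim: s1 s2 F => [|a s1 IH] s2 F.
  by move=> /perm_size/eqP; rewrite eq_sym => /nilP ->.
move=> p12; have as2 : a \in s2 by rewrite -(perm_mem p12) mem_head.
case/path.splitPr: as2 p12 => u v p12.
rewrite dd_rotate cat_cons; move: p12; rewrite perm_sym perm_catC cat_cons.
rewrite perm_cons perm_sym => p12; rewrite /= -(IH _ _ p12).
have := perm_size p12.
by case: (s1) => [|c s1']; case: (v ++ u).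
Qed.

Definition poly_jet p : nat -> K -> K := fun i x => (p^`(i)).[x].

Lemma poly_jet_mulXsub p c i x :
  poly_jet (p * ('X - c%:P)) i x =
  poly_jet p i x * (x - c) + (if i is j.+1 then i%:R * poly_jet p j x else 0).
Proof.
rewrite /poly_jet.
have H j : (p * ('X - c%:P))^`(j.+1) = p^`(j.+1) * ('X - c%:P) + p^`(j) *+ j.+1.
  elim: j => [|j IHj]; first by rewrite !derivn1 derivM derivXsubC mulr1.
  rewrite derivnS IHj derivD derivM derivXsubC mulr1 derivMn -!derivnS.
  by rewrite -addrA -mulrS.
case: i => [|i]; first by rewrite /= !hornerE.
by rewrite H !hornerE hornerMn mulr_natl.
Qed.

Lemma poly_jetDC p c i x :
  poly_jet (p + c%:P) i x = poly_jet p i x + (if i is 0 then c else 0).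
Proof. by rewrite /poly_jet derivnD; case: i => [|i]; rewrite ?derivnC !hornerE. Qed.

(** Horner step for the difference quotient: if [f x = x * p x + c], then
[(f x - f a) / (x - a) = a * (p x - p a) / (x - a) + p x]. *)
Lemma dq_poly_jet_cons a p c :
  dq a (poly_jet (p * 'X + c%:P)) =
  (fun i x => a * dq a (poly_jet p) i x + poly_jet p i x).
Proof.
have J i x : poly_jet (p * 'X + c%:P) i x =
    (poly_jet p i x * x + (if i is j.+1 then i%:R * poly_jet p j x else 0))
    + (if i is 0 then c else 0).
  by rewrite poly_jetDC -['X]subr0 -polyC0 poly_jet_mulXsub subr0.
apply: dq_unique => [x|i x|i]; rewrite ?J ?addr0.
- by rewrite mulrDr mulrCA dq0E; ring.
- by rewrite mulrDr mulrCA dqSE; ring.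
- by rewrite dq_diag; field; rewrite addrC natr1 pnatr_eq0.
Qed.

(** Multiplicities in [s] count the derivatives to match.  Interpolate the
difference quotient at the remaining points, then multiply back by [X - a]. *)
Lemma hermite_interpolation F s :
  exists p, forall x i, (i < count_mem x s)%N -> poly_jet p i x = F i x.
Proof.
elim: s F => [|a s IH] F; first by exists 0.
have [q Hq] := IH (dq a F); exists (q * ('X - a%:P) + (F 0 a)%:P) => x i.
rewrite poly_jetDC poly_jet_mulXsub [count_mem x (a :: s)]/=.
case: (eqVneq a x) => [<-|ax]; rewrite ?add0n ?add1n.
  case: i => [|i]; first by rewrite subrr mulr0 !add0r.
  rewrite ltnS => /Hq ->; rewrite subrr mulr0 add0r addr0 dq_diag.
  by rewrite mulrC divfK // pnatr_eq0.
case: i => [|i] Hi; rewrite ?addr0; first by rewrite Hq // mulrC dq0E subrK.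
by rewrite !Hq ?(ltnW Hi) // mulrC dqSE subrK.
Qed.

Lemma interpolate_on (s : seq K) m F :
  exists p, jets_agree m [set x | x \in s] (poly_jet p) F.
Proof.
have [p Hp] := hermite_interpolation F (flatten (nseq m s)).
exists p => i x im /= xs; apply: Hp; apply: (leq_trans im).
elim: {im} m => [//|m IH] /=; rewrite count_cat -add1n leq_add //.
by rewrite -has_count has_pred1.
Qed.

End Jets.

(** * Orthogonal diagonalization of real symmetric matrices *)

Section SpectralTheorem.
Variable R : rcfType.
Local Notation C := (complex.complex R).

Lemma row_dot0 n (u : 'rV[R]_n) : (u *m u^T) 0 0 = \sum_j u 0 j ^+ 2.
Proof. by rewrite mxE; apply: eq_bigr => j _; rewrite mxE expr2. Qed.

Lemma row_dot_ge0 n (u : 'rV[R]_n) : 0 <= (u *m u^T) 0 0.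
Proof. by rewrite row_dot0 sumr_ge0 // => j _; rewrite sqr_ge0. Qed.

Lemma row_dot_eq0 n (u : 'rV[R]_n) : ((u *m u^T) 0 0 == 0) = (u == 0).
Proof.
rewrite row_dot0 psumr_eq0; last by move=> j _; rewrite sqr_ge0.
apply/idP/eqP => [/allP H|->]; last by apply/allP => j _; rewrite mxE expr0n eqxx.
by apply/rowP => j; rewrite mxE; have := H j (mem_index_enum _); rewrite sqrf_eq0 => /eqP.
Qed.

(** Over the complex numbers there is an eigenvector [x + iy] for some [a + ib].
Evaluating the symmetric form of [A] at [(x, y)] in both ways gives
[b * (|x|^2 + |y|^2) = 0], so that [x] and [y] are real eigenvectors for [a],
as far as they are nonzero. *)
Lemma symmetric_eigenvector n (A : 'M[R]_n.+1) : A^T = A ->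
  exists a (v : 'rV[R]_n.+1), v != 0 /\ v *m A = a *: v.
Proof.
move=> symA; pose A' : 'M[C]_n.+1 := map_mx (@complex.real_complex_def R (Phant R)) A.
have [//|[a b] /eigenvalueP[v vA v0]] := @eigenvalue_closed C n.+1 A'.
pose x : 'rV[R]_n.+1 := \row_j complex.Re (v 0 j).
pose y : 'rV[R]_n.+1 := \row_j complex.Im (v 0 j).
have xA : x *m A = a *: x - b *: y.
  apply/rowP => j; have /rowP/(_ j)/(congr1 (@complex.Re R)) := vA.
  rewrite !mxE raddf_sum /=; case E: (v 0 j) => [p q] /= <-.
  by apply: eq_bigr => k _; rewrite !mxE; case: (v 0 k) => r s /=; rewrite mulr0 subr0.
have yA : y *m A = a *: y + b *: x.
  apply/rowP => j; have /rowP/(_ j)/(congr1 (@complex.Im R)) := vA.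
  rewrite !mxE raddf_sum /=; case E: (v 0 j) => [p q] /= <-.
  by apply: eq_bigr => k _; rewrite !mxE; case: (v 0 k) => r s /=; rewrite mulr0 add0r mulrC.
have xy0 : (x != 0) || (y != 0).
  apply: contraNT v0; rewrite negb_or !negbK => /andP[/eqP/rowP x0 /eqP/rowP y0].
  apply/eqP/rowP => j; have := x0 j; have := y0 j; rewrite !mxE.
  by case: (v 0 j) => p q /= -> ->.
have b0 : b = 0.
  have /(congr1 (fun M : 'M[R]_1 => M 0 0)) : x *m A *m y^T = (y *m A *m x^T)^T.
    by rewrite !trmx_mul trmxK symA mulmxA.
  have tr2 : (y *m x^T) 0 0 = (x *m y^T) 0 0.
    by rewrite !mxE; apply: eq_bigr => k _; rewrite !mxE mulrC.
  have xy_pos : (x *m x^T) 0 0 + (y *m y^T) 0 0 != 0.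
    by rewrite paddr_eq0 ?row_dot_ge0 // !row_dot_eq0 negb_and.
  rewrite xA yA mulmxBl mulmxDl -!scalemxAl.
  move: (x *m x^T) (y *m y^T) (x *m y^T) (y *m x^T) tr2 xy_pos => p q r s rs pq.
  rewrite !mxE rs => H; have : b * (p 0 0 + q 0 0) = 0 by move: H; lra.
  by move/eqP; rewrite mulf_eq0 (negPf pq) orbF => /eqP.
move: xA yA; rewrite b0 !scale0r subr0 addr0 => xA yA.
by case/orP: xy0 => h; [exists a, x | exists a, y].
Qed.

(** The reflection exchanging the unit vectors [e_0] and [v]. *)
Lemma householder n (v : 'rV[R]_n.+1) : (v *m v^T) 0 0 = 1 ->
  exists Q : 'M[R]_n.+1, [/\ Q^T = Q, Q *m Q = 1%:M & delta_mx 0 0 *m Q = v].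
Proof.
move=> v1; pose e : 'rV[R]_n.+1 := delta_mx 0 0.
case: (eqVneq v e) => [->|ve].
  by exists 1%:M; rewrite trmx1 !mulmx1.
pose w := v - e; pose c := (w *m w^T) 0 0.
have c0 : c != 0 by rewrite row_dot_eq0 subr_eq0.
have ww : w *m w^T = c%:M by rewrite [LHS]mx11_scalar.
have e1 : (e *m e^T) 0 0 = 1 by rewrite trmx_delta mul_delta_mx mxE.
have ew : e *m w^T = (- c / 2)%:M.
  rewrite [LHS]mx11_scalar; congr (_%:M).
  have ve1 : (v *m e^T) 0 0 = (e *m v^T) 0 0.
    by rewrite !mxE; apply: eq_bigr => k _; rewrite !mxE mulrC.
  have : c = (v *m v^T) 0 0 - (e *m v^T) 0 0 - (v *m e^T) 0 0 + (e *m e^T) 0 0.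
    rewrite /c /w linearB /= mulmxBl !mulmxBr.
    set p := v *m _; set q := _ *m _; set r := e *m _; set t := e *m _.
    by rewrite !mxE; ring.
  have -> : (e *m w^T) 0 0 = (e *m v^T) 0 0 - (e *m e^T) 0 0.
    by rewrite /w linearB /= mulmxBr; set p := e *m _; set q := e *m _; rewrite !mxE.
  by rewrite v1 e1 ve1 => ->; field.
have wE : e + w = v by rewrite addrC subrK.
clearbody c w.
exists (1%:M - (2 / c) *: (w^T *m w)); split.
- by rewrite linearB linearZ /= trmx1 trmx_mul trmxK.
- rewrite mulmxBl mul1mx mulmxBr. rewrite mulmx1 -!scalemxAl -!scalemxAr.
  rewrite mulmxA -(mulmxA w^T w) ww mul_mx_scalar -scalemxAl.
  rewrite scalerA scalerA (_ : 2 / c * (2 / c * c) = 2 / c + 2 / c); last by field.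
  by rewrite scalerDl opprB addrK subrK.
- rewrite mulmxBr mulmx1 -scalemxAr mulmxA ew mul_scalar_mx scalerA.
  rewrite (_ : 2 / c * (- c / 2) = -1); last by field.
  by rewrite scaleN1r opprK.
Qed.

(** Move a unit eigenvector to [e_0] by a reflection: symmetry clears the rest of
the first row and column, and the induction applies to the remaining block. *)
Theorem symmetric_diagonalization n (A : 'M[R]_n) : A^T = A ->
  exists (V : 'M[R]_n) (d : 'rV[R]_n),
    V *m V^T = 1%:M /\ A = V *m diag_mx d *m V^T.
Proof.
elim: n A => [|n IH] A symA.
  by exists 1%:M, 0; split; apply/matrixP => -[].
have [a [v [v0 vA]]] := symmetric_eigenvector symA.
pose c := Num.sqrt ((v *m v^T) 0 0).
have c0 : c != 0.
  by rewrite gt_eqF // sqrtr_gt0 lt_neqAle row_dot_ge0 eq_sym row_dot_eq0 v0.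
have u1 : ((c^-1 *: v) *m (c^-1 *: v)^T) 0 0 = 1.
  rewrite linearZ /= -scalemxAl -scalemxAr scalerA mxE -invfM -expr2.
  by rewrite sqr_sqrtr ?row_dot_ge0 // mulVf // row_dot_eq0.
have [Q [QT QQ eQ]] := householder u1.
have uA : (c^-1 *: v) *m A = a *: (c^-1 *: v).
  by rewrite -scalemxAl vA !scalerA mulrC.
pose B : 'M[R]_(1 + n) := Q *m A *m Q.
have BT : B^T = B by rewrite /B !trmx_mul QT symA mulmxA.
have B0 : (delta_mx 0 0 : 'rV[R]_(1 + n)) *m B = a *: delta_mx 0 0.
  rewrite /B !mulmxA; rewrite -[RHS]mulmx1 -QQ mulmxA -scalemxAl.
  by rewrite eQ uA.
have B0j j : B 0 j = a *+ (j == 0).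
  have /rowP/(_ j) := B0; rewrite -rowE !mxE eqxx /= => ->.
  by rewrite mulr_natr.
have BQ : B = Q *m A *m Q by [].
clearbody B.
have l0 : lshift n (0 : 'I_1) = 0 :> 'I_(1 + n) by apply: val_inj.
have Bur : ursubmx B = 0.
  by apply/matrixP => i j; rewrite !mxE ord1 l0 B0j -l0 eq_rlshift mulr0n.
have Bul : ulsubmx B = a%:M.
  by apply/matrixP => i j; rewrite !mxE !ord1 l0 B0j !eqxx.
have Bdl : dlsubmx B = 0.
  by rewrite -[dlsubmx B]trmxK trmx_dlsub BT Bur trmx0.
have Bdr : (drsubmx B)^T = drsubmx B by rewrite trmx_drsub BT.
have [V1 [d1 [V1o Bd]]] := IH _ Bdr.
pose W : 'M[R]_(1 + n) := block_mx 1%:M 0 0 V1.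
have WT : W^T = block_mx 1%:M 0 0 V1^T by rewrite tr_block_mx trmx1 !trmx0.
have WW : W *m W^T = 1%:M.
  rewrite WT /W mulmx_block !mulmx0 !mul0mx !addr0 !add0r mulmx1 V1o.
  by rewrite -scalar_mx_block.
have BE : B = W *m diag_mx (row_mx a%:M d1) *m W^T.
  rewrite diag_mx_row WT /W. rewrite !mulmx_block !(mulmx0, mul0mx, addr0, add0r).
  rewrite mulmx1 mul1mx -Bd -[LHS]submxK Bul Bur Bdl; congr block_mx.
  by apply/matrixP => i j; rewrite !ord1 !mxE.
exists (Q *m W), (row_mx a%:M d1 : 'rV_(1 + n)); split.
  by rewrite trmx_mul QT mulmxA -(mulmxA Q) WW mulmx1.
have QBQ : A = Q *m B *m Q by rewrite BQ !mulmxA QQ mul1mx -mulmxA QQ mulmx1.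
by rewrite QBQ BE trmx_mul QT !mulmxA.
Qed.
End SpectralTheorem.

(** * Derivatives relative to an interval *)

Section RelativeDerivative.
Variable R : realType.
Implicit Types (I : set R) (f h : R -> R) (a c d x : R).

(** The first-order expansion form of a derivative relative to [I]; unlike the
limit of the difference quotient it needs no case distinction at [a]. *)
Definition has_deriv I f a d : Prop :=
  forall e, 0 < e ->
    \forall x \near a, I x -> `|f x - f a - d * (x - a)| <= e * `|x - a|.

Lemma has_derivP I f a d :
  has_deriv I f a d <-> diff_quot f a @ within I a^' --> d.
Proof.
split=> [H|/cvgrPdist_le H e e0].
  apply/cvgrPdist_le => e e0; have := H e e0; rewrite /within /dnbhs /=.
  rewrite /within /=; apply: filterS => x + xa Ix => /(_ Ix).
  have u0 : x - a != 0 by rewrite subr_eq0.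
  rewrite -[X in _ <= X -> _]/(e * `|x - a|) -ler_pdivrMr ?normr_gt0 //.
  rewrite -normf_div distrC; congr (`|_| <= _).
  by rewrite /diff_quot mulrBl mulfK.
have {}H : \forall x \near a, x != a -> I x -> `|d - diff_quot f a x| <= e.
  exact: H.
apply: filterS H => x Hx Ix; case: (eqVneq x a) => [->|xa].
  by rewrite !subrr mulr0 subrr normr0 mulr0.
have u0 : x - a != 0 by rewrite subr_eq0.
have := Hx xa Ix; rewrite distrC /diff_quot => {}Hx.
have -> : f x - f a - d * (x - a) = ((f x - f a) / (x - a) - d) * (x - a).
  by rewrite mulrBl divfK.
by rewrite normrM ler_wpM2r.
Qed.

Lemma near_dist a e : 0 < e -> \forall x \near a, `|x - a| < e.
Proof.
by move=> e0; near=> x; rewrite distrC; near: x; exact: nbhsx_ballx.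
Unshelve. all: by end_near. Qed.

Lemma has_deriv_cont I f a d : has_deriv I f a d ->
  forall e, 0 < e -> \forall x \near a, I x -> `|f x - f a| <= e.
Proof.
move=> H e e0; have k0 : 0 < 1 + `|d| by rewrite ltr_pwDl.
have := near_dist a (divr_gt0 e0 k0); apply: filterS2 (H 1 ltr01) => x H1 H2 Ix.
have -> : f x - f a = (f x - f a - d * (x - a)) + d * (x - a) by rewrite subrK.
apply: le_trans (ler_normD _ _) _; rewrite normrM.
apply: le_trans (lerD (H1 Ix) (lexx _)) _; rewrite -mulrDl mulrC.
by rewrite -ler_pdivlMr // ltW.
Qed.

Lemma has_deriv_eq_near I f h a d : f a = h a ->
  (\forall x \near a, I x -> f x = h x) ->
  has_deriv I f a d -> has_deriv I h a d.
Proof.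
move=> fha fh H e e0; apply: filterS2 fh (H e e0) => x Hx + Ix => /(_ Ix).
by rewrite Hx // fha.
Qed.

Lemma has_deriv_cst I c a : has_deriv I (fun=> c) a 0.
Proof.
move=> e e0; near=> x => _.
by rewrite subrr mul0r subrr normr0 mulr_ge0 // ltW.
Unshelve. all: by end_near. Qed.

Lemma has_deriv_subr I c a : has_deriv I (fun x => x - c) a 1.
Proof.
move=> e e0; near=> x => _.
by rewrite mul1r opprB addrA subrK subrr normr0 mulr_ge0 // ltW.
Unshelve. all: by end_near. Qed.

Lemma has_derivD I f h a c d : has_deriv I f a c -> has_deriv I h a d ->
  has_deriv I (fun x => f x + h x) a (c + d).
Proof.
move=> Hf Hh e e0; have e2 : 0 < e / 2 by rewrite divr_gt0.
apply: filterS2 (Hf _ e2) (Hh _ e2) => x {}Hf {}Hh Ix.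
have -> : f x + h x - (f a + h a) - (c + d) * (x - a) =
    (f x - f a - c * (x - a)) + (h x - h a - d * (x - a)) by ring.
apply: le_trans (ler_normD _ _) _.
by apply: le_trans (lerD (Hf Ix) (Hh Ix)) _; rewrite -mulrDl -splitr.
Qed.

Lemma has_derivM I f h a c d : has_deriv I f a c -> has_deriv I h a d ->
  has_deriv I (fun x => f x * h x) a (c * h a + f a * d).
Proof.
move=> Hf Hh e e0; pose k := 1 + `|h a| + `|f a| + `|c|.
have k0 : 0 < k by rewrite /k -!addrA ltr_pwDl // !addr_ge0.
have ek : 0 < e / k by rewrite divr_gt0.
have hc := has_deriv_cont Hh.
near=> x => Ix.
have H1 : `|f x - f a - c * (x - a)| <= e / k * `|x - a|.
  by move: Ix; near: x; exact: Hf.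
have H2 : `|h x - h a - d * (x - a)| <= e / k * `|x - a|.
  by move: Ix; near: x; exact: Hh.
have H3 : `|h x - h a| <= e / k by move: Ix; near: x; exact: hc.
have H4 : `|h x| <= 1 + `|h a|.
  have : `|h x - h a| <= 1 by move: Ix; near: x; exact: hc.
  rewrite -[h x in X in _ -> X](subrK (h a)) => H5.
  by apply: le_trans (ler_normD _ _) _; rewrite lerD2r.
have -> : f x * h x - f a * h a - (c * h a + f a * d) * (x - a) =
   (f x - f a - c * (x - a)) * h x + f a * (h x - h a - d * (x - a)) +
   c * (x - a) * (h x - h a) by ring.
have -> : e * `|x - a| = e / k * `|x - a| * (1 + `|h a|) +
     `|f a| * (e / k * `|x - a|) + `|c| * `|x - a| * (e / k).
  rewrite (_ : e = e / k * k); last by rewrite divfK // gt_eqF.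
  by rewrite {2}/k mulfK ?gt_eqF //; ring.
apply: le_trans (ler_normD _ _) _; apply: lerD; last first.
  by rewrite !normrM ler_wpM2l // mulr_ge0.
apply: le_trans (ler_normD _ _) _; rewrite !normrM; apply: lerD; last first.
  by rewrite ler_wpM2l.
by rewrite ler_pM.
Unshelve. all: by end_near. Qed.

Lemma has_derivZ I f k a d : has_deriv I f a d ->
  has_deriv I (fun x => k * f x) a (k * d).
Proof.
move=> H; have := has_derivM (@has_deriv_cst I k a) H.
by rewrite mul0r add0r.
Qed.

Lemma has_derivB I f h a c d : has_deriv I f a c -> has_deriv I h a d ->
  has_deriv I (fun x => f x - h x) a (c - d).
Proof.
move=> Hf Hh; have := has_derivD Hf (@has_derivZ I h (-1) a d Hh).
rewrite mulN1r; congr has_deriv; apply/funext => x; by rewrite mulN1r.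
Qed.

Lemma has_deriv_expr I c a i :
  has_deriv I (fun x => (x - c) ^+ i.+1) a (i.+1%:R * (a - c) ^+ i).
Proof.
elim: i => [|i IH]; first by rewrite expr0 mulr1; exact: has_deriv_subr.
have := has_derivM (has_deriv_subr I c a) IH.
rewrite mul1r mulrCA -exprS -{1}[_ ^+ i.+1]mul1r -mulrDl nat1r.
by congr has_deriv; apply/funext => x; rewrite -exprS.
Qed.

(** Division by [x - c] near a point [a] other than [c]; [h] is prescribed only
off [c] so that the lemma applies directly to difference quotients. *)
Lemma has_deriv_quot I f h c a d : a != c ->
  (forall x, x != c -> h x = f x / (x - c)) -> has_deriv I f a d ->
  has_deriv I h a ((d - h a) / (a - c)).
Proof.
move=> ac hE Hf; set b := a - c; have b0 : b != 0 by rewrite subr_eq0.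
suff Hi : has_deriv I (fun x => (x - c)^-1) a (- b^-2).
  have := has_derivM Hf Hi; rewrite -/b.
  have -> : d / b + f a * - b ^- 2 = (d - h a) / b.
    by rewrite hE // -/b; field.
  apply: has_deriv_eq_near; first by rewrite hE.
  near=> x => _; rewrite hE // -subr_eq0 -normr_gt0.
  have : `|x - a| < `|b| by near: x; apply: near_dist; rewrite normr_gt0.
  move=> xab; rewrite (_ : x - c = b - (a - x)); last by rewrite /b; ring.
  apply: lt_le_trans (lerB_dist _ _).
  by rewrite subr_gt0 distrC.
move=> e e0; have b3 : 0 < `|b| / 2 by rewrite divr_gt0 ?normr_gt0.
near=> x => _.
have x1 : `|x - a| < `|b| / 2 by near: x; apply: near_dist.
have x2 : `|x - a| < e * `|b| ^+ 3 / 2.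
  by near: x; apply: near_dist; rewrite divr_gt0 // mulr_gt0 // exprn_gt0 ?normr_gt0.
have x3 : `|b| / 2 <= `|x - c|.
  rewrite (_ : x - c = b - (a - x)); last by rewrite /b; ring.
  apply: le_trans (lerB_dist _ _).
  by move: x1; rewrite distrC; lra.
have xc0 : x - c != 0 by rewrite -normr_gt0 (lt_le_trans b3).
have -> : (x - c)^-1 - (a - c)^-1 - - b^-2 * (x - a) =
    (x - a) * ((x - a) / (b ^+ 2 * (x - c))).
  have -> : x - a = (x - c) - b by rewrite /b; ring.
  by rewrite -/b; field; rewrite xc0 b0.
rewrite normrM mulrC ler_wpM2r // normf_div normrM normrX.
rewrite ler_pdivrMr ?mulr_gt0 ?exprn_gt0 ?normr_gt0 //.
apply: le_trans (ltW x2) _.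
rewrite -mulrA ler_pM2l // exprSr -mulrA ler_wpM2l // exprn_ge0 //.
Unshelve. all: by end_near. Qed.

(** A nondegenerate interval accumulates at each of its points, hence limits
within it are unique. *)
Lemma derive_on_unique I f a d : is_interval I -> I° !=set0 -> I a ->
  has_deriv I f a d -> derive_on I f a = d.
Proof.
move=> hI [z Iz] Ia /has_derivP H.
suff P : ProperFilter (within I a^') by exact: cvg_lim H.
apply: Build_ProperFilter_ex => P /nbhs_ballP[e /= e0 He].
(* a second point of the interval, towards which the filter can be tested *)
have [y Iy ya] : exists2 y, I y & y != a.
  case: (eqVneq z a) => [za|]; last by exists z => //; exact: interior_subset.
  move/nbhs_ballP: Iz => [r /= r0 Hr]; exists (z + r / 2).
    apply: Hr; rewrite /ball /= opprD addNKr normrN gtr0_norm ?divr_gt0 //; lra.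
  by rewrite -za -subr_eq0 addrC addKr gt_eqF // divr_gt0.
have ya0 : 0 < `|y - a| by rewrite normr_gt0 subr_eq0.
pose t := Num.min 1 (e / 2 / `|y - a|).
have t0 : 0 < t by rewrite lt_min ltr01 !divr_gt0.
have t1 : t <= 1 by rewrite ge_min lexx.
exists (a + t * (y - a)); apply: He.
- rewrite /ball /= opprD addNKr normrN normrM gtr0_norm //.
  rewrite (@le_lt_trans _ _ (e / 2)) //; last by lra.
  by rewrite -ler_pdivlMr // ge_min lexx orbT.
- by rewrite -subr_eq0 addrC addKr mulf_neq0 ?subr_eq0 // gt_eqF.
- case: (ltP a y) => h.
    by apply: (hI a y) => //; apply/andP; split; nra.
  by apply: (hI y a) => //; apply/andP; split; nra.
Qed.

Lemma has_deriv_is_derive I f a d : nbhs a I -> has_deriv I f a d ->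
  is_derive a 1 f d.
Proof.
move=> nI H; suff C : h^-1 *: (f (h *: 1 + a) - f a) @[h --> 0^'] --> d.
  split; first by apply/cvg_ex; exists d.
  by rewrite /derive; exact: cvg_lim C.
apply/cvgrPdist_le => e e0.
have /nbhs_ballP[r /= r0 Hr] : \forall x \near a,
    I x /\ (I x -> `|f x - f a - d * (x - a)| <= e * `|x - a|).
  by apply: filterI => //; exact: H.
near=> t.
have t0 : t != 0 by near: t; exact: nbhs_dnbhs_neq.
have tr : `|t| < r by near: t; exact: dnbhs0_lt.
have [|It /(_ It)] := Hr (t + a).
  by rewrite /ball /= opprD addrCA subrr addr0 normrN.
rewrite [_ *: 1]mulr1 addrK -ler_pdivrMr ?normr_gt0 // -normf_div distrC.
congr (`|_| <= _).
by rewrite mulrBl mulfK // mulrC.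
Unshelve. all: by end_near. Qed.

Definition strictly_between (a x t : R) := (a < t < x) || (x < t < a).

(** Between two points of [I] a relative derivative is a derivative, while at the
two points themselves only continuity is required. *)
Lemma has_deriv_Rolle I f f' a x : is_interval I -> I a -> I x -> a != x ->
  (forall t, I t -> has_deriv I f t (f' t)) -> f a = f x ->
  exists2 t, strictly_between a x t & f' t = 0.
Proof.
move=> hI; wlog ax : a x / a < x.
  move=> W Ia Ix ax Hf fE; case: (ltgtP a x) => h; last by rewrite h eqxx in ax.
    exact: W.
  have [|t] := W x a h Ix Ia _ Hf (esym fE); first by rewrite eq_sym.
  by rewrite /strictly_between orbC; exists t.
move=> Ia Ix _ Hf fE.
have nb t : t \in `]a, x[%R -> nbhs t I.
  rewrite in_itv /= => /andP[at_ tx]; have : t \in `]a, x[%R by rewrite in_itv /= at_ tx.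
  move/near_in_itv; apply: filterS => s; rewrite in_itv /= => /andP[as_ sx].
  by apply: (hI a x) => //; rewrite !ltW.
have It t : t \in `[a, x]%R -> I t.
  by rewrite in_itv /=; exact: hI.
have D t : t \in `]a, x[%R -> is_derive t 1 f (f' t).
  move=> tax; apply: has_deriv_is_derive (nb _ tax) _.
  by apply: Hf; apply: It; apply: subset_itv_oo_cc.
have [| |t tax f0] := Rolle ax _ _ fE.
- by move=> t /D [].
- apply/subspace_continuousP => t /= tax; apply/cvgrPdist_le => e e0.
  have := has_deriv_cont (Hf t (It _ tax)) e0.
  rewrite /within /=; apply: filterS => s Hs sax.
  by rewrite distrC; apply: Hs; exact: It.
exists t; first by move: tax; rewrite in_itv /= /strictly_between => ->.
by have [_ <-] := D t tax; have [_ ->] := f0.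
Qed.

End RelativeDerivative.

(** * Difference quotients of differentiable functions *)

Section Towers.
Variables (R : realType) (I : set R).
Hypotheses (hI : is_interval I).
Implicit Types (F : nat -> R -> R) (a x : R) (m i : nat).

Definition tower m F : Prop :=
  forall i a, (i < m)%N -> I a -> has_deriv I (F i) a (F i.+1 a).

Lemma towerW m m' F : (m' <= m)%N -> tower m F -> tower m' F.
Proof. by move=> mm H i a im; apply: H; exact: leq_trans im mm. Qed.

(** The product [(t - a)^(i+1) * dq a F i t] is, up to sign and factor, the
Taylor remainder of [F 0] expanded at [t] and evaluated at [a].  Its
derivative telescopes, and the formula has no singularity at [a]. *)
Lemma has_deriv_remainder m F a i x : tower m.+1 F -> (i <= m)%N -> I x ->
  has_deriv I (fun t => (t - a) ^+ i.+1 * dq a F i t) x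
    ((x - a) ^+ i * F i.+1 x).
Proof.
move=> tF; elim: i => [|i IH] im Ix.
  have := has_derivB (tF 0 x im Ix) (@has_deriv_cst R I (F 0 a) x).
  rewrite subr0 expr0 mul1r; congr has_deriv; apply/funext => t.
  by rewrite expr1 dq0E.
have := has_derivB (has_derivM (has_deriv_expr I a x i) (tF i.+1 x im Ix))
  (has_derivZ i.+1%:R (IH (ltnW im) Ix)).
rewrite -!mulrA addrAC subrr add0r; congr has_deriv; apply/funext => t.
by rewrite [in RHS]exprSr -mulrA dqSE mulrBr mulrCA.
Qed.

(** Rolle applied to the remainder, corrected by multiples of [(t - a)^(i+1)] and
[(t - a)^(i+2)] to vanish at both ends.  The free slope [b] allows a
first-order expansion of [F i.+1] to be transferred to [dq a F i]. *)
Lemma dq_mean_value m F a x (b : R) i : tower m.+1 F -> (i <= m)%N ->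
  I a -> I x -> a != x ->
  exists2 t, strictly_between a x t &
    dq a F i x = (F i.+1 t - b * (t - a)) / i.+1%:R + b * (x - a) / i.+2%:R.
Proof.
move=> tF im Ia Ix ax.
(* c is chosen to make the corrected remainder vanish at x *)
pose d := b / i.+2%:R; pose c := dq a F i x - d * (x - a).
pose f t := (t - a) ^+ i.+1 * dq a F i t - (c * (t - a) ^+ i.+1 + d * (t - a) ^+ i.+2).
pose f' t := (t - a) ^+ i * F i.+1 t -
  (c * (i.+1%:R * (t - a) ^+ i) + d * (i.+2%:R * (t - a) ^+ i.+1)).
have Hf t : I t -> has_deriv I f t (f' t).
  move=> It; apply: has_derivB; first exact: has_deriv_remainder tF im It.
  by apply: has_derivD; apply: has_derivZ; exact: has_deriv_expr.
have [|t tb H] := has_deriv_Rolle hI Ia Ix ax Hf.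
  rewrite /f subrr !expr0n /= mul0r !mulr0 addr0 subr0.
  by rewrite [(x - a) ^+ i.+2]exprS /c; ring.
have ta : t - a != 0.
  rewrite subr_eq0; move: tb; rewrite /strictly_between.
  by case/orP=> /andP[h1 h2]; rewrite ?(gt_eqF h1) ?(lt_eqF h2).
have n1 : i.+1%:R != 0 :> R by rewrite pnatr_eq0.
have n2 : i.+2%:R != 0 :> R by rewrite pnatr_eq0.
have Ft : F i.+1 t = c * i.+1%:R + d * (i.+2%:R * (t - a)).
  apply: (mulfI (expf_neq0 i ta)); move: H => /eqP; rewrite subr_eq0 => /eqP ->.
  by rewrite exprS; ring.
by exists t => //; rewrite Ft /c /d; field; rewrite nat1r -natrD n1 n2.
Qed.

Lemma strictly_betweenW a x t : strictly_between a x t -> `|t - a| <= `|x - a|.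
Proof.
rewrite /strictly_between => /orP[] /andP[h1 h2].
  by rewrite !ger0_norm ?subr_ge0 ?lerD2r ?ltW // (lt_trans h1).
by rewrite !ler0_norm ?subr_le0 ?lerN2 ?lerD2r ?ltW // (lt_trans h1).
Qed.

Lemma strictly_between_in a x t : I a -> I x -> strictly_between a x t -> I t.
Proof.
move=> Ia Ix /orP[] /andP[h1 h2]; first by apply: (hI Ia Ix); rewrite !ltW.
by apply: (hI Ix Ia); rewrite !ltW.
Qed.

(** A difference quotient loses exactly one derivative.  At [a] itself, the
first-order expansion of [F i.+1] is transferred by the mean value formula with
slope [F i.+2 a]. *)
Lemma tower_dq m F a : I a -> tower m.+1 F -> tower m (dq a F).
Proof.
move=> Ia tF i x im Ix; case: (eqVneq x a) => [->|xa]; last first.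
  have xa0 : x - a != 0 by rewrite subr_eq0.
  elim: i im => [|i IH] im.
    have := has_derivB (tF 0 x (ltnW im) Ix) (@has_deriv_cst R I (F 0 a) x).
    rewrite subr0 => H.
    have -> : dq a F 1 x = (F 1 x - dq a F 0 x) / (x - a).
      by apply: (mulfI xa0); rewrite dqSE mul1r [RHS]mulrC divfK.
    apply: (has_deriv_quot xa) H => t ta.
    by rewrite [dq a F 0 t]/= (negPf ta).
  have := has_derivB (tF i.+1 x (ltnW im) Ix) (has_derivZ i.+1%:R (IH (ltnW im))).
  move=> H; have -> : dq a F i.+2 x =
     (F i.+2 x - i.+1%:R * dq a F i.+1 x - dq a F i.+1 x) / (x - a).
    apply: (mulfI xa0); rewrite dqSE [RHS]mulrC divfK // -addrA -opprD.
    by rewrite -[X in _ - (_ + X)]mul1r -mulrDl natr1.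
  apply: (has_deriv_quot xa) H => t ta.
  by rewrite [LHS]/= (negPf ta).
rewrite (dq_diag a F i.+1) => e e0.
have /nbhs_ballP[r /= r0 Hr] := tF i.+1 a im Ia e e0.
rewrite dq_diag; near=> t => It; case: (eqVneq t a) => [->|ta].
  by rewrite dq_diag !subrr mulr0 subrr normr0 mulr0.
have tr : `|t - a| < r by near: t; exact: near_dist.
rewrite eq_sym in ta.
have [u ub ->] := dq_mean_value (F i.+2 a) tF (ltnW im) Ia It ta.
have := Hr u; rewrite /ball /= distrC => /(_ (le_lt_trans (strictly_betweenW ub) tr)).
move=> /(_ (strictly_between_in Ia It ub)) Hu.
have n1 : i.+1%:R != 0 :> R by rewrite pnatr_eq0.
have n2 : i.+2%:R != 0 :> R by rewrite pnatr_eq0.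
have -> : (F i.+1 u - F i.+2 a * (u - a)) / i.+1%:R + F i.+2 a * (t - a) / i.+2%:R
   - F i.+1 a / i.+1%:R - F i.+2 a / i.+2%:R * (t - a) =
   (F i.+1 u - F i.+1 a - F i.+2 a * (u - a)) / i.+1%:R.
  by field; rewrite nat1r -natrD n1 n2.
rewrite normrM normfV normr_nat ler_pdivrMr ?ltr0Sn //.
apply: le_trans Hu _; rewrite -mulrA ler_pM2l //.
apply: le_trans (strictly_betweenW ub) _.
by rewrite ler_peMr // ler1n.
Unshelve. all: by end_near. Qed.

(** Neighbourhoods of a finite spectrum are unions of small intervals: points at
distance less than [d] lie in the same one.  Mean values can be taken only
within one interval. *)
Definition locally_convex (d : R) (U : set R) : Prop := U `<=` I /\
  forall a x t, U a -> U x -> `|x - a| < d -> strictly_between a x t -> U t.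

Definition jet_bound m (U : set R) (B : R) F : Prop :=
  forall i x, (i <= m)%N -> U x -> `|F i x| <= B.

(** Points at distance less than [d] are treated by the mean value formula; for
the others the denominators are at least [d]. *)
Lemma dq_bound (d : R) i : 0 < d -> exists2 C, 0 < C &
  forall U F a x B, locally_convex d U -> tower i.+1 F -> U a -> U x ->
    jet_bound i.+1 U B F -> `|dq a F i x| <= C * B.
Proof.
move=> d0; elim: i => [|i [C C0 IH]].
  exists (1 + 2 / d); first by rewrite addr_gt0 // divr_gt0.
  move=> U F a x B [UI Uc] tF Ua Ux HB.
  have B0 : 0 <= B by apply: le_trans (HB 0 a _ Ua).
  case: (eqVneq a x) => [<-|ax].
    rewrite dq_diag divr1; apply: le_trans (HB _ _ _ Ua) _ => //.
    by rewrite ler_peMl // lerDl ltW // divr_gt0.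
  case: (ltP `|x - a| d) => xad.
    have [t tb ->] := dq_mean_value 0 tF (leqnn _) (UI _ Ua) (UI _ Ux) ax.
    rewrite !mul0r subr0 addr0 divr1.
    apply: le_trans (HB _ _ _ (Uc _ _ _ Ua Ux xad tb)) _ => //.
    by rewrite ler_peMl // lerDl ltW // divr_gt0.
  have xa0 : 0 < `|x - a| by apply: lt_le_trans xad.
  have := congr1 Num.norm (dq0E a F x); rewrite normrM => H.
  rewrite -(ler_pM2l xa0) H.
  apply: le_trans (ler_normB _ _) _.
  apply: le_trans (lerD (HB 0 x _ Ux) (HB 0 a _ Ua)) _ => //.
  rewrite mulrA; apply: (@le_trans _ _ (d * (2 / d) * B)).
    by rewrite (mulrC d) divfK ?gt_eqF // mulr_natl mulr2n.
  rewrite ler_wpM2r //; apply: ler_pM => //; first exact: ltW.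
    by rewrite divr_ge0 // ltW.
  by rewrite lerDr.
exists (1 + (1 + i.+1%:R * C) / d).
  by rewrite addr_gt0 // divr_gt0 // ltr_pwDl // mulr_ge0 // ltW.
move=> U F a x B UU tF Ua Ux HB; have [UI Uc] := UU.
have B0 : 0 <= B by apply: le_trans (HB 0 a _ Ua).
have D0 : 0 <= (1 + i.+1%:R * C) / d.
  by rewrite divr_ge0 // ?ltW // ltr_pwDl // mulr_ge0 // ltW.
have n1 : 1 <= i.+2%:R :> R by rewrite ler1n.
case: (eqVneq a x) => [<-|ax].
  rewrite dq_diag normrM normfV normr_nat ler_pdivrMr ?ltr0Sn //.
  apply: le_trans (HB _ _ _ Ua) _ => //.
  by rewrite -mulrA mulrC -mulrA ler_peMr // mulrC mulr_ege1 // lerDl.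
case: (ltP `|x - a| d) => xad.
  have [t tb ->] := dq_mean_value 0 tF (leqnn _) (UI _ Ua) (UI _ Ux) ax.
  rewrite !mul0r subr0 addr0 normrM normfV normr_nat ler_pdivrMr ?ltr0Sn //.
  apply: le_trans (HB _ _ _ (Uc _ _ _ Ua Ux xad tb)) _ => //.
  by rewrite -mulrA mulrC -mulrA ler_peMr // mulrC mulr_ege1 // lerDl.
have xa0 : 0 < `|x - a| by apply: lt_le_trans xad.
have := congr1 Num.norm (dqSE a F i x); rewrite normrM => H.
rewrite -(ler_pM2l xa0) H.
have Hi : `|dq a F i x| <= C * B.
  apply: (IH U) => //; first exact: towerW tF.
  by move=> j y ji; apply: HB; exact: leq_trans ji _.
apply: le_trans (ler_normB _ _) _; rewrite normrM normr_nat.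
apply: le_trans (lerD (HB _ x _ Ux) (ler_wpM2l _ Hi)) _ => //.
rewrite [leRHS]mulrA; apply: (@le_trans _ _ (d * ((1 + i.+1%:R * C) / d) * B)).
  by rewrite (mulrC d) divfK ?gt_eqF // mulrDl mul1r mulrA.
rewrite ler_wpM2r //; apply: ler_pM => //; first exact: ltW.
by rewrite lerDr.
Qed.

Lemma dq_jet_bound (d : R) m : 0 < d -> exists2 C, 0 < C &
  forall U F a B, locally_convex d U -> tower m.+1 F -> U a ->
    jet_bound m.+1 U B F -> jet_bound m U (C * B) (dq a F).
Proof.
move=> d0; elim: m => [|m [C C0 IH]].
  have [C C0 HC] := @dq_bound d 0 d0; exists C => // U F a B UU tF Ua HB i x.
  by rewrite leqn0 => /eqP -> Ux; exact: (HC U).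
have [C' C'0 HC'] := @dq_bound d m.+1 d0; exists (C + C'); first exact: addr_gt0.
move=> U F a B UU tF Ua HB i x; rewrite leq_eqVlt => /orP[/eqP ->|im] Ux.
  have B0 : 0 <= B by apply: le_trans (HB 0 a _ Ua).
  apply: le_trans (HC' U F a x B UU tF Ua Ux HB) _.
  by rewrite ler_wpM2r // lerDr ltW.
have B0 : 0 <= B by apply: le_trans (HB 0 a _ Ua).
apply: le_trans (IH U F a B UU _ Ua _ i x im Ux) _.
- exact: towerW tF.
- by move=> j y jm; apply: HB; exact: leq_trans jm _.
by rewrite ler_wpM2r // lerDl ltW.
Qed.

Lemma has_deriv_poly (p : {poly R}) a : has_deriv I (horner p) a (p^`()).[a].
Proof.
elim/poly_ind: p => [|p c IH].
  rewrite deriv0 horner0; have := @has_deriv_cst R I 0 a; congr has_deriv.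
  by apply/funext => x; rewrite horner0.
have := has_derivD (has_derivM IH (has_deriv_subr I 0 a)) (@has_deriv_cst R I c a).
rewrite derivD derivC derivM derivX !hornerE subr0; congr has_deriv.
by apply/funext => x; rewrite !hornerE subr0.
Qed.

Lemma tower_poly_jet m (p : {poly R}) : tower m (poly_jet p).
Proof.
move=> i a _ _; have := has_deriv_poly p^`(i) a; rewrite -derivnS.
by [].
Qed.

Lemma towerB m F E : tower m F -> tower m E ->
  tower m (fun i x => F i x - E i x).
Proof. by move=> hF hE i a im Ia; apply: has_derivB; [exact: hF|exact: hE]. Qed.

Lemma times_differentiable_tower m (g : R -> R) :
  times_differentiable_on I m g -> tower m (fun i => iter i (derive_on I) g).
Proof. by move=> H i a im Ia; apply/has_derivP; exact: (H i im a Ia). Qed.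

End Towers.

(** * Noncommutative words of a matrix function *)

Section MatrixNorm.
Variable R : realType.

Lemma mx_norm_le m n (A : 'M[R]_(m, n)) c : 0 <= c ->
  (forall i j, `|A i j| <= c) -> `|A| <= c.
Proof.
move=> c0 H; rewrite [leLHS]/Num.norm /= mx_normrE; by apply/bigmax_leP; split.
Qed.

Lemma le_mx_norm m n (A : 'M[R]_(m, n)) i j : `|A i j| <= `|A|.
Proof.
rewrite [leRHS]/Num.norm /= mx_normrE.
by apply/bigmax_geP; right => /=; exists (i, j).
Qed.

Lemma mx_norm_mul m n p (A : 'M[R]_(m, n)) (B : 'M[R]_(n, p)) :
  `|A *m B| <= n%:R * `|A| * `|B|.
Proof.
apply: mx_norm_le => [|i j]; first by rewrite !mulr_ge0.
rewrite mxE; apply: le_trans (ler_norm_sum _ _ _) _.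
have -> : n%:R * `|A| * `|B| = \sum_(k < n) `|A| * `|B|.
  by rewrite sumr_const card_ord mulr_natl mulrnAl.
apply: ler_sum => k _; rewrite normrM.
by apply: ler_pM => //; exact: le_mx_norm.
Qed.

Lemma mx_norm_tr m n (A : 'M[R]_(m, n)) : `|A^T| = `|A|.
Proof.
apply/eqP; rewrite eq_le; apply/andP; split; apply: mx_norm_le => // i j.
  by rewrite mxE; exact: le_mx_norm.
by rewrite (_ : A i j = A^T j i) ?le_mx_norm // mxE.
Qed.

Lemma mx_norm_scalar n (a : R) : `|a%:M : 'M[R]_n| <= `|a|.
Proof.
apply: mx_norm_le => // i j; rewrite mxE.
by case: (i == j); rewrite ?mulr1n ?mulr0n ?normr0.
Qed.

End MatrixNorm.

Section Words.
Variables (R : realType) (n : nat).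
Implicit Types (F E : nat -> R -> R) (mu : 'rV[R]_n) (H X Y Z : 'M[R]_n).
Implicit Types (s : seq 'M[R]_n) (c : seq R).

(** In an eigenbasis, the multilinear part of a matrix function that meets the
directions of [s] in this order: the entry [(i, j)] sums, over all paths
[i = i_0, ..., i_k = j], the divided difference at [mu_{i_0}, ..., mu_{i_k}]
times the entries of the directions along the path. *)
Fixpoint word F mu s (i j : 'I_n) : R :=
  if s is H :: s' then \sum_l H i l * word (dq (mu 0 i) F) mu s' l j
  else F 0 (mu 0 i) *+ (i == j).

Definition word_mx F mu s : 'M[R]_n := \matrix_(i, j) word F mu s i j.

Lemma word_linear (a : R) F E mu s i j :
  word (fun m x => a * F m x + E m x) mu s i j =
  a * word F mu s i j + word E mu s i j.
Proof.
elim: s F E i j => [|H s IH] F E i j /=; first by rewrite mulrnDl mulrnAr.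
rewrite dq_linear mulr_sumr -big_split; apply: eq_bigr => l _ /=.
by rewrite IH mulrDr mulrCA.
Qed.

Lemma word_agree F E mu s i j :
  jets_agree (size s).+1 (range (mu 0)) F E -> word F mu s i j = word E mu s i j.
Proof.
elim: s F E i j => [|H s IH] F E i j FE /=.
  by rewrite FE //; exists i.
apply: eq_bigr => l _; rewrite (IH _ (dq (mu 0 i) E)) //.
by apply: dq_agree => //; exists i.
Qed.

(** For the polynomial with coefficient list [c], the sum of all products
[X^a_0 H_1 X^a_1 ... H_k X^a_k] weighted by the coefficient of degree
[a_0 + ... + a_k + k], organized as a Horner scheme. *)
Fixpoint ncpoly c X s : 'M[R]_n :=
  if c is a :: c' then
    if s is H :: s' then X *m ncpoly c' X s + H *m ncpoly c' X s'
    else a%:M + X *m ncpoly c' X [::]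
  else 0.

(** The Horner scheme of [ncpoly] and that of the divided differences of a
polynomial, [dq_poly_jet_cons], are the same recursion. *)
Lemma word_poly c mu s :
  word_mx (poly_jet (Poly c)) mu s = ncpoly c (diag_mx mu) s.
Proof.
apply/matrixP => i j; rewrite mxE; elim: c s i j => [|a c IH] s i j /=.
  rewrite mxE; have := word_linear (-1) (poly_jet 0) (poly_jet 0) mu s i j.
  have -> : (fun m x => -1 * poly_jet (0 : {poly R}) m x + poly_jet 0 m x) = poly_jet 0.
    apply/funext => m; apply/funext => x; rewrite mulN1r addNr /poly_jet.
    by rewrite linear0 horner0.
  by rewrite mulN1r addNr.
rewrite cons_poly_def; case: s => [|H s] /=; rewrite mul_diag_mx !mxE.
  rewrite -IH /= /poly_jet /= !hornerE addrC.
  by case: (i == j); rewrite ?mulr1n ?mulr0n ?mulr0 ?addr0 // [in LHS]mulrC.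
rewrite -IH -[X in _ = _ + X](eq_bigr _ (fun l _ => congr1 (GRing.mul (H i l)) (IH s l j))).
rewrite dq_poly_jet_cons /= mulr_sumr -big_split; apply: eq_bigr => l _ /=.
by rewrite word_linear mulrDr mulrCA.
Qed.

Lemma ncpoly_conj c V X s : V *m V^T = 1%:M ->
  ncpoly c (V *m X *m V^T) s =
  V *m ncpoly c X [seq V^T *m H *m V | H <- s] *m V^T.
Proof.
move=> VV; have VV' : V^T *m V = 1%:M := mulmx1C VV.
elim: c s => [|a c IH] s /=; first by rewrite mulmx0 mul0mx.
case: s => [|H s] /=; rewrite mulmxDr mulmxDl ?IH /=.
  by rewrite mul_mx_scalar -scalemxAl VV scalemx1 !mulmxA -[_ *m V^T *m V]mulmxA VV' mulmx1.
rewrite !mulmxA; congr (_ + _).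
  by rewrite -[_ *m V^T *m V]mulmxA VV' mulmx1.
by rewrite VV mul1mx.
Qed.

(** A word of [F] depends on finitely many derivatives on the spectrum, so it
equals the word of any Hermite interpolant, and for polynomials the
eigenbasis can be dispensed with. *)
Lemma word_ncpoly c F V mu s : V *m V^T = 1%:M ->
  jets_agree (size s).+1 (range (mu 0)) F (poly_jet (Poly c)) ->
  V *m word_mx F mu [seq V^T *m H *m V | H <- s] *m V^T =
  ncpoly c (V *m diag_mx mu *m V^T) s.
Proof.
move=> VV FE; rewrite ncpoly_conj // -word_poly; congr (_ *m _ *m _).
apply/matrixP => i j; rewrite !mxE; apply: word_agree.
by rewrite size_map.
Qed.

Lemma ncpoly_linear c X s1 (a : R) H H' s2 :
  ncpoly c X (s1 ++ (a *: H + H') :: s2) =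
  a *: ncpoly c X (s1 ++ H :: s2) + ncpoly c X (s1 ++ H' :: s2).
Proof.
elim: c s1 s2 => [|b c IH] s1 s2 /=; first by rewrite scaler0 addr0.
case: s1 => [|K s1] /=.
  have := IH [::] s2; rewrite /= => ->.
  rewrite mulmxDr mulmxDl -scalemxAr -scalemxAl scalerDr.
  by rewrite addrACA.
have := IH (K :: s1) s2; rewrite /= => ->; rewrite IH.
by rewrite !mulmxDr -!scalemxAr scalerDr addrACA.
Qed.

Definition norm_prod s : R := \prod_(H <- s) `|H|.

Lemma norm_prod_ge0 s : 0 <= norm_prod s.
Proof. by rewrite /norm_prod; apply: prodr_ge0. Qed.

Lemma norm_prod_cons H s : norm_prod (H :: s) = `|H| * norm_prod s.
Proof. by rewrite /norm_prod big_cons. Qed.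

Let N : R := n%:R.

Lemma mx_norm_mul_le (A B : 'M[R]_n) a b : `|A| <= a -> `|B| <= b ->
  `|A *m B| <= N * a * b.
Proof.
move=> Aa Bb; apply: le_trans (mx_norm_mul _ _) _.
have a0 : 0 <= a by apply: le_trans Aa.
by apply: ler_pM => //; rewrite ?mulr_ge0 // ler_wpM2l.
Qed.

Lemma ncpoly_bound c (r : R) k : 0 <= r -> exists2 C, 0 <= C &
  forall X s, `|X| <= r -> size s = k -> `|ncpoly c X s| <= C * norm_prod s.
Proof.
move=> r0; elim: c k => [|a c IH] k.
  by exists 0 => // X s _ _; rewrite /= normr0 mul0r.
have [C1 C10 H1] := IH k; case: k H1 => [|k] H1.
  exists (`|a| + N * r * C1) => [|X s Xr /size0nil ->].
    by rewrite addr_ge0 // !mulr_ge0.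
  rewrite /= /norm_prod big_nil mulr1.
  apply: le_trans (ler_normD _ _) _; apply: lerD; first exact: mx_norm_scalar.
  apply: mx_norm_mul_le => //; have := H1 X [::] Xr (erefl _).
  by rewrite /norm_prod big_nil mulr1.
have [C2 C20 H2] := IH k; exists (N * r * C1 + N * C2) => [|X [//|H s] Xr [sk]].
  by rewrite addr_ge0 // !mulr_ge0.
rewrite [ncpoly _ _ _]/=; apply: le_trans (ler_normD _ _) _.
rewrite mulrDl; apply: lerD.
  rewrite [leRHS](_ : _ = N * r * (C1 * norm_prod (H :: s))); last by ring.
  apply: mx_norm_mul_le => //.
  by apply: H1 => //=; rewrite sk.
rewrite norm_prod_cons [leRHS](_ : _ = N * `|H| * (C2 * norm_prod s)); last by ring.
by apply: mx_norm_mul_le => //; exact: H2.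
Qed.

Lemma ncpoly_lipschitz c (r : R) k : 0 <= r -> exists2 C, 0 <= C &
  forall X Y s, `|X| <= r -> `|Y| <= r -> size s = k ->
    `|ncpoly c Y s - ncpoly c X s| <= C * `|Y - X| * norm_prod s.
Proof.
move=> r0; elim: c k => [|a c IH] k.
  by exists 0 => // X Y s _ _ _; rewrite /= subrr normr0 !mul0r.
have [B B0 HB] := ncpoly_bound c k r0.
have [C1 C10 H1] := IH k.
have K (X Y : 'M[R]_n) s : `|X| <= r -> `|Y| <= r -> size s = k ->
  `|Y *m ncpoly c Y s - X *m ncpoly c X s| <=
  (N * B + N * r * C1) * `|Y - X| * norm_prod s.
  move=> Xr Yr sk.
  have -> : Y *m ncpoly c Y s - X *m ncpoly c X s = (Y - X) *m ncpoly c Y s +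
     X *m (ncpoly c Y s - ncpoly c X s).
    by rewrite mulmxBl mulmxBr addrA subrK.
  apply: le_trans (ler_normD _ _) _; rewrite !mulrDl; apply: lerD.
    rewrite [leRHS](_ : _ = N * `|Y - X| * (B * norm_prod s)); last by ring.
    by apply: mx_norm_mul_le => //; exact: HB.
  rewrite [leRHS](_ : _ = N * r * (C1 * `|Y - X| * norm_prod s)); last by ring.
  by apply: mx_norm_mul_le => //; exact: H1.
case: k HB H1 K => [|k] HB H1 K.
  exists (N * B + N * r * C1) => [|X Y s Xr Yr sk].
    by rewrite addr_ge0 // !mulr_ge0.
  have := K X Y s Xr Yr sk; rewrite (size0nil sk) /=.
  by rewrite opprD addrACA subrr add0r.
have [C2 C20 H2] := IH k; exists (N * B + N * r * C1 + N * C2) => [|X Y s Xr Yr sk].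
  by rewrite !addr_ge0 // !mulr_ge0.
case: s sk => [//|H s] sk; have := K X Y _ Xr Yr sk.
rewrite [ncpoly (_ :: _) _ _]/= [ncpoly (_ :: _) X _]/= => {}K.
rewrite opprD addrACA -mulmxBr.
apply: le_trans (ler_normD _ _) _; rewrite 2!mulrDl; apply: lerD => //.
rewrite norm_prod_cons [leRHS](_ : _ = N * `|H| * (C2 * `|Y - X| * norm_prod s)); last by ring.
by apply: mx_norm_mul_le => //; apply: H2 => //; case: sk.
Qed.

Definition insert_at (T : Type) (j : nat) (x : T) (s : seq T) := take j s ++ x :: drop j s.

(** The derivative of a word in the direction [Z] inserts [Z] at every position.
Subtracting the Horner steps leaves [X] times a remainder, [H] times a
shorter remainder, and [(Y - X)] times a first-order difference; the last is
quadratically small by [ncpoly_lipschitz]. *)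
Lemma ncpoly_taylor c (r : R) k : 0 <= r -> exists2 C, 0 <= C &
  forall X Y s, `|X| <= r -> `|Y| <= r -> size s = k ->
    `|ncpoly c Y s - ncpoly c X s -
      \sum_(j < k.+1) ncpoly c X (insert_at j (Y - X) s)|
    <= C * `|Y - X| ^+ 2 * norm_prod s.
Proof.
move=> r0; elim: c k => [|a c IH] k.
  exists 0 => // X Y s _ _ _; rewrite /= subrr sub0r normrN.
  by rewrite big1 // normr0 !mul0r.
have [L L0 HL] := ncpoly_lipschitz c k r0.
have [C1 C10 H1] := IH k.
pose D c k X Y s := ncpoly c Y s - ncpoly c X s -
      \sum_(j < k.+1) ncpoly c X (insert_at j (Y - X) s).
have K (X Y : 'M[R]_n) s : `|X| <= r -> `|Y| <= r -> size s = k ->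
  `|X *m D c k X Y s + (Y - X) *m (ncpoly c Y s - ncpoly c X s)| <=
  (N * r * C1 + N * L) * `|Y - X| ^+ 2 * norm_prod s.
  move=> Xr Yr sk; apply: le_trans (ler_normD _ _) _; rewrite !mulrDl; apply: lerD.
    rewrite [leRHS](_ : _ = N * r * (C1 * `|Y - X| ^+ 2 * norm_prod s)); last by ring.
    by apply: mx_norm_mul_le => //; exact: H1.
  rewrite [leRHS](_ : _ = N * `|Y - X| * (L * `|Y - X| * norm_prod s)); last by ring.
  by apply: mx_norm_mul_le => //; exact: HL.
case: k HL H1 K => [|k] HL H1 K.
  exists (N * r * C1 + N * L) => [|X Y s Xr Yr sk].
    by rewrite addr_ge0 // !mulr_ge0.
  have := K X Y s Xr Yr sk; rewrite (size0nil sk) /D !big_ord1 /=.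
  congr (`|_| <= _).
  rewrite !mulmxBr !mulmxBl.
  move: (Y *m _) (X *m _) (X *m _) (Y *m _) (X *m _) => P1 P2 P3 P4 P5.
  by apply/matrixP => i j; rewrite !mxE; ring.
have [C2 C20 H2] := IH k.
exists (N * r * C1 + N * L + N * C2) => [|X Y s Xr Yr sk].
  by rewrite !addr_ge0 // !mulr_ge0.
case: s sk => [//|H s] sk; have {}K := K X Y _ Xr Yr sk.
have ks : size s = k by case: sk.
have {}H2 := H2 X Y _ Xr Yr ks.
rewrite 2!mulrDl; set p := norm_prod _.
pose S1 := \sum_(j < k.+1) ncpoly c X (H :: insert_at j (Y - X) s).
pose S2 := \sum_(j < k.+1) ncpoly c X (insert_at j (Y - X) s).
have E1 : \sum_(j < k.+2) ncpoly c X (insert_at j (Y - X) (H :: s)) =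
    ncpoly c X [:: Y - X, H & s] + S1.
  by rewrite big_ord_recl; congr (_ + _); apply: eq_bigr.
have E2 : \sum_(j < k.+2) ncpoly (a :: c) X (insert_at j (Y - X) (H :: s)) =
    X *m ncpoly c X [:: Y - X, H & s] + (Y - X) *m ncpoly c X (H :: s) +
    (X *m S1 + H *m S2).
  rewrite big_ord_recl; congr (_ + _).
  by rewrite !mulmx_sumr -big_split; apply: eq_bigr.
have -> : ncpoly (a :: c) Y (H :: s) - ncpoly (a :: c) X (H :: s) -
     \sum_(j < k.+2) ncpoly (a :: c) X (insert_at j (Y - X) (H :: s)) =
  (X *m D c k.+1 X Y (H :: s) +
     (Y - X) *m (ncpoly c Y (H :: s) - ncpoly c X (H :: s))) +
  H *m D c k X Y s.
  rewrite /D E1 E2 -/S2 [ncpoly (a :: c) Y _]/= [ncpoly (a :: c) X _]/=.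
  rewrite !mulmxBr !mulmxDr !mulmxBl.
  set P1 := X *m _; set P2 := Y *m _; set P3 := X *m _; set P4 := Y *m _.
  set P5 := X *m _; set P6 := H *m _; set P7 := H *m _; set P8 := H *m _.
  set P9 := X *m _.
  clearbody P1 P2 P3 P4 P5 P6 P7 P8 P9.
  by apply/matrixP => i j; rewrite !mxE; ring.
apply: le_trans (ler_normD _ _) _; apply: lerD => //.
rewrite /p norm_prod_cons.
rewrite [leRHS](_ : _ = N * `|H| * (C2 * `|Y - X| ^+ 2 * norm_prod s)); last by ring.
by apply: mx_norm_mul_le.
Qed.

(** A word of length [k] involves divided differences of order [k] only, each
bounded by the derivatives of order at most [k] near the points involved. *)
Lemma word_small (I : set R) (d : R) k : is_interval I -> 0 < d ->
  exists2 C, 0 <= C & forall U F mu s B,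
    locally_convex I d U -> tower I k F -> (forall i, U (mu 0 i)) ->
    jet_bound k U B F -> size s = k ->
    forall i j, `|word F mu s i j| <= C * B * norm_prod s.
Proof.
move=> hI d0; elim: k => [|k [C C0 IH]].
  exists 1 => // U F mu s B UU tF Umu HB /size0nil -> i j /=.
  rewrite mul1r /norm_prod big_nil mulr1.
  have Fi := HB 0%N (mu 0 i) (leqnn _) (Umu i).
  case: (i == j); rewrite ?mulr1n ?mulr0n //.
  by rewrite normr0; apply: le_trans Fi.
have [C' C'0 HC'] := dq_jet_bound hI k d0.
exists (N * C * C') => [|U F mu [//|H s] B UU tF Umu HB [sk] i j /=].
  by rewrite !mulr_ge0 // ltW.
apply: le_trans (ler_norm_sum _ _ _) _; rewrite norm_prod_cons.
have -> : N * C * C' * B * (`|H| * norm_prod s) =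
    \sum_(l < n) `|H| * (C * (C' * B) * norm_prod s).
  by rewrite sumr_const card_ord -mulr_natl; ring.
apply: ler_sum => l _; rewrite normrM; apply: ler_pM => //.
  exact: le_mx_norm.
apply: (IH U) => //; first by apply: tower_dq => //; exact: UU.1.
exact: HC'.
Qed.

End Words.

(** * Permutations, insertions and cycles *)

Lemma lift_perm_surj n (s : 'S_n.+1) i j : s i = j -> exists s', s = lift_perm i j s'.
Proof.
move=> sij; pose f k := odflt k (unlift j (s (lift i k))).
have fK k : lift j (f k) = s (lift i k).
  rewrite /f; have : j != s (lift i k).
    by rewrite -sij (inj_eq perm_inj) neq_lift.
  by case/unlift_some => k' -> ->.
have f_inj : injective f.
  move=> k k' /(congr1 (lift j)); rewrite !fK => /perm_inj; exact: lift_inj.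
exists (perm f_inj); apply/permP => k.
case: (unliftP i k) => [k' ->|->]; last by rewrite lift_perm_id.
by rewrite lift_perm_lift permE fK.
Qed.

Lemma lift_perm_inj n (i j : 'I_n.+1) : injective (lift_perm i j).
Proof.
move=> s s' e; apply/permP => k; apply: (@lift_inj _ j).
by rewrite -!(lift_perm_lift i) e.
Qed.

(** A permutation is determined by the position of the value [j] and by what
remains after deleting it. *)
Lemma sum_lift_perm (V : nmodType) n (j : 'I_n.+1) (f : 'S_n.+1 -> V) :
  \sum_s f s = \sum_i \sum_s f (lift_perm i j s).
Proof.
rewrite (partition_big (fun s : 'S_n.+1 => (s^-1)%g j) xpredT) //=.
apply: eq_bigr => i _.
have -> : \sum_s f (lift_perm i j s) = \sum_(s in predT) f (lift_perm i j s) by [].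
rewrite -(big_imset f (h := lift_perm i j)) /=; last by move=> s s' _ _; exact: lift_perm_inj.
apply: eq_bigl => s; apply/eqP/imsetP => [<-|[s' _ ->]].
  by have [|s' E] := @lift_perm_surj _ s ((s^-1)%g j) j; [rewrite permKV | exists s'].
by apply: (@perm_inj _ (lift_perm i j s')); rewrite permKV lift_perm_id.
Qed.

Section SnocInsert.
Variable T : Type.

Lemma nth_insert_at x0 j (x : T) s m : (j <= size s)%N ->
  nth x0 (insert_at j x s) m =
  if (m < j)%N then nth x0 s m else if m == j then x else nth x0 s m.-1.
Proof.
move=> js; rewrite /insert_at nth_cat size_takel //.
case: ltngtP => [mj|jm|->]; [by rewrite nth_take | | by rewrite subnn].
case: m jm => [//|m]; rewrite ltnS => jm.
by rewrite subSn //= nth_drop subnKC.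
Qed.

Lemma size_insert_at j (x : T) s : size (insert_at j x s) = (size s).+1.
Proof. by rewrite /insert_at size_cat /= addnS -size_cat cat_take_drop. Qed.

Lemma snoc_lift k (h : 'I_k -> T) x i : snoc h x (lift ord_max i) = h i.
Proof. by rewrite /snoc liftK. Qed.

Lemma snoc_max k (h : 'I_k -> T) x : snoc h x ord_max = x.
Proof. by rewrite /snoc unlift_none. Qed.

(** The orderings of [k.+1] directions are obtained from those of the first [k]
by inserting the last direction at an arbitrary place. *)
Lemma map_snoc_lift_perm k (h : 'I_k -> T) x (j : 'I_k.+1) (s : 'S_k) :
  [seq snoc h x (lift_perm j ord_max s i) | i <- enum 'I_k.+1] =
  insert_at j x [seq h (s i) | i <- enum 'I_k].
Proof.
have sz : size [seq h (s i) | i <- enum 'I_k] = k by rewrite size_map size_enum_ord.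
apply: (@eq_from_nth _ x) => [|m]; first by rewrite size_insert_at sz size_map size_enum_ord.
rewrite size_map size_enum_ord => mk.
rewrite (nth_map j) ?size_enum_ord // (_ : nth j _ m = Ordinal mk); last first.
  by apply: val_inj; rewrite /= nth_enum_ord.
rewrite nth_insert_at ?sz -1?ltnS //.
case: (unliftP j (Ordinal mk)) => [m' E|E]; rewrite E; last first.
  by rewrite lift_perm_id snoc_max -E /= ltnn eqxx.
have mE : m = bump j m' by move/(congr1 val): E.
rewrite lift_perm_lift snoc_lift.
have nthE p (pk : (p < k)%N) : nth x [seq h (s i) | i <- enum 'I_k] p = h (s (Ordinal pk)).
  rewrite (nth_map (Ordinal pk)) ?size_enum_ord //; congr (h (s _)).
  by apply: val_inj; rewrite /= nth_enum_ord.
have m'k := ltn_ord m'.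
rewrite mE /bump; case: (leqP j m') => jm'; rewrite [nat_of_bool _]/= ?add1n ?add0n.
  case: ltnP => [|_]; first by lia.
  rewrite gtn_eqF //= (nthE _ m'k).
  by congr (h (s _)); exact: val_inj.
case: ltnP => [_|]; last by lia.
rewrite (nthE _ m'k).
by congr (h (s _)); exact: val_inj.
Qed.

End SnocInsert.

Section Cycles.

Lemma one_cycleP n (t : 'S_n.+1) (x : 'I_n.+1) :
  reflect (forall y, y \in porbit t x) (one_cycle t).
Proof.
rewrite /one_cycle; apply: (iffP cards1P) => [[A E] y|H].
  have xA : porbit t x = A by apply/set1P; rewrite -E; exact: imset_f.
  have yA : porbit t y = A by apply/set1P; rewrite -E; exact: imset_f.
  by rewrite xA -yA porbit_id.
exists (porbit t x); apply/setP => A; rewrite inE.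
apply/imsetP/eqP => [[y _ ->]|->]; last by exists x.
by apply/eqP; rewrite eq_porbit_mem; exact: H.
Qed.

(** Bypassing the last point in a cycle leaves a cycle. *)
Lemma one_cycle_insert n (t : 'S_n.+2) : one_cycle t ->
  exists t' l, one_cycle t' /\ t = insert_cycle t' l.
Proof.
move=> ct; pose m : 'I_n.+2 := ord_max; pose a := (t^-1)%g m.
have ta : t a = m by rewrite permKV.
have am : m != a.
  apply/eqP => ma; have /(one_cycleP _ m)/(_ ord0) := ct.
  have tm : t m = m by rewrite {1}ma.
  case/porbitP => i; suff -> : (t ^+ i)%g m = m by [].
  by elim: i => [|i IH]; rewrite ?expg0 ?perm1 // expgSr permM IH.
have [l aE _] := unlift_some am.
have [|t' t'E] := @lift_perm_surj _ (tperm a m * t)%g m m.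
  by rewrite permM tpermR.
have tE : t = insert_cycle t' l.
  by rewrite /insert_cycle -t'E -aE -/m mulgA tperm2 mul1g.
exists t', l; split=> //.
apply/(one_cycleP t' l) => y.
(* the retraction merging the last point with its predecessor l *)
pose r (v : 'I_n.+2) := odflt l (unlift m v).
have rl z : r (lift m z) = z by rewrite /r liftK.
have rm : r m = l by rewrite /r unlift_none.
have rt v : r (t v) = r v \/ r (t v) = t' (r v).
  rewrite tE /insert_cycle permM; case: (unliftP m v) => [z ->|->].
    rewrite rl; case: (eqVneq z l) => [->|zl].
      by rewrite tpermL lift_perm_id rm; left.
    rewrite tpermD ?lift_perm_lift ?rl ?neq_lift //; first by right.
    by rewrite (inj_eq (@lift_inj _ m)) eq_sym.
  by rewrite tpermR lift_perm_lift rl rm; right.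
have /porbitP[i yE] : lift m y \in porbit t m by move/(one_cycleP _ m): ct.
rewrite -(rl y) yE.
elim: i {yE} => [|i IH]; first by rewrite expg0 perm1 rm porbit_id.
rewrite expgSr permM; have [->//|->] := rt ((t ^+ i)%g m).
by case/porbitP: IH => p ->; rewrite -permM -expgSr mem_porbit.
Qed.

End Cycles.

(** * Eigenvalues of symmetric matrices *)

Section SymmetricSpectrum.
Variables (R : realType) (n : nat).
Implicit Types (X Y : sym R n) (V U : 'M[R]_n) (mu nu : 'rV[R]_n).

Lemma char_poly_conj_diag V mu : V *m V^T = 1%:M ->
  char_poly (V *m diag_mx mu *m V^T) = \prod_(i < n) ('X - (mu 0 i)%:P).
Proof.
move=> VV; have VV' : V^T *m V = 1%:M := mulmx1C VV.
pose M := map_mx (@polyC R).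
have -> : char_poly (V *m diag_mx mu *m V^T) = char_poly (diag_mx mu).
  rewrite /char_poly /char_poly_mx.
  have -> : 'X%:M - M n n (V *m diag_mx mu *m V^T) =
      M n n V *m ('X%:M - M n n (diag_mx mu)) *m M n n V^T.
    rewrite mulmxBr mulmxBl -!map_mxM; congr (_ - _).
    by rewrite mul_mx_scalar -scalemxAl -map_mxM VV map_mx1 scalemx1.
  rewrite !det_mulmx mulrAC -det_mulmx -map_mxM VV map_mx1 det1 mul1r.
  by [].
rewrite char_poly_trig; last exact: diag_mx_is_trig.
by apply: eq_bigr => i _; rewrite mxE eqxx mulr1n.
Qed.

Lemma sorted_reordering mu : exists (nu : 'rV[R]_n),
  (forall i j : 'I_n, (i <= j)%N -> nu 0 j <= nu 0 i) /\
  \prod_(i < n) ('X - (nu 0 i)%:P) = \prod_(i < n) ('X - (mu 0 i)%:P).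
Proof.
pose s := [seq mu 0 i | i <- enum 'I_n].
pose t := sort (fun x y : R => y <= x) s.
have sz : size t = n by rewrite size_sort size_map size_enum_ord.
have st : sorted (fun x y : R => y <= x) t.
  by apply: sort_sorted => x y; rewrite orbC le_total.
exists (\row_i t`_i); split.
  move=> i j ij; rewrite !mxE.
  apply: (sorted_leq_nth _ _ 0 st) => //; rewrite ?inE ?sz //.
  by move=> y x z xy yz; exact: le_trans yz xy.
have -> : \prod_(i < n) ('X - ((\row_i t`_i) 0 i)%:P) = \prod_(x <- t) ('X - x%:P).
  rewrite (big_nth 0) sz big_mkord; apply: eq_bigr => i _.
  by rewrite mxE.
rewrite (perm_big s) /=; last by rewrite perm_sort.
by rewrite big_map big_enum.
Qed.

(** The diagonal found by [symmetric_diagonalization] and [lambda X] are the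
roots of the same polynomial, hence agree up to a permutation, which is then
applied to the columns. *)
Lemma diagonalizer_exists X : exists V, is_diagonalizer X V.
Proof.
have symX : (symval X)^T = symval X by apply/eqP; case: X.
have [U [d [UU XE]]] := symmetric_diagonalization symX.
have [nu [nu_sorted nuE]] := sorted_reordering d.
have [_ lamE] : is_eigenvalue_vector X (lambda X).
  apply: xgetPex; exists nu; split=> //.
  by rewrite XE char_poly_conj_diag // nuE.
have pE : perm_eq [seq lambda X 0 i | i <- enum 'I_n] [tuple d 0 i | i < n].
  apply: prod_XsubC_eq; rewrite big_map big_enum /= -lamE XE char_poly_conj_diag //.
  by rewrite big_map big_enum.
have /tuple_permP[p dE] := pE.
have dp i : lambda X 0 i = d 0 (p i).
  have := congr1 (fun s => nth 0 s i) dE.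
  rewrite (nth_map i) ?size_enum_ord // nth_ord_enum => ->.
  by rewrite /= (nth_map i) ?size_enum_ord // nth_ord_enum tnth_mktuple.
exists (col_perm p U); split.
  rewrite /orthogonal_mx; apply/matrixP => i j; rewrite -UU !mxE.
  rewrite [RHS](reindex_inj (@perm_inj _ p)) /=.
  by apply: eq_bigr => k _; rewrite !mxE.
rewrite [LHS]XE !mul_mx_diag; apply/matrixP => i j; rewrite !mxE.
rewrite [LHS](reindex_inj (@perm_inj _ p)) /=.
by apply: eq_bigr => k _; rewrite !mxE dp.
Qed.

Definition diagonalizer X : 'M[R]_n := xget 1%:M [set V | is_diagonalizer X V].

Lemma diagonalizerP X : is_diagonalizer X (diagonalizer X).
Proof.
have [V VX] := diagonalizer_exists X.
exact: (@xgetPex _ _ [set V | is_diagonalizer X V]) (ex_intro _ V VX).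
Qed.

Lemma orthogonal_mx_norm V : V *m V^T = 1%:M -> `|V| <= 1.
Proof.
move=> VV; apply: mx_norm_le => // i j.
have H : (V *m V^T) i i = 1 by rewrite VV mxE eqxx.
move: H; rewrite mxE (bigD1 j) //= !mxE => H.
have V2 : `|V i j| ^+ 2 <= 1.
  rewrite -normrX ger0_norm ?sqr_ge0 // -H expr2 lerDl sumr_ge0 // => k _.
  by rewrite mxE -expr2 sqr_ge0.
by rewrite -(@ler_pXn2r _ 2) ?nnegrE // expr1n.
Qed.

Lemma orthogonal_conj_norm V (M : 'M[R]_n) : V *m V^T = 1%:M ->
  `|V *m M *m V^T| <= n%:R ^+ 2 * `|M|.
Proof.
move=> VV; have V1 := orthogonal_mx_norm VV.
have VT1 : `|V^T| <= 1 by rewrite mx_norm_tr.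
rewrite (_ : _ ^+ 2 * _ = n%:R * (n%:R * 1 * `|M|) * 1); last by ring.
apply: mx_norm_mul_le => //; exact: mx_norm_mul_le.
Qed.

(** Between the two eigenbases, the difference [Z] of the matrices has
entries [(nu_j - mu_i) * Q_ij], where [Q] is orthogonal; since the column [j]
of [Q] is a unit vector, one of its entries is at least [1 / n]. *)
Lemma spectrum_variation V U mu nu j :
  V *m V^T = 1%:M -> U *m U^T = 1%:M ->
  exists i, `|nu 0 j - mu 0 i| <=
    n%:R ^+ 3 * `|U *m diag_mx nu *m U^T - V *m diag_mx mu *m V^T|.
Proof.
move=> VV UU.
have VV' : V^T *m V = 1%:M := mulmx1C VV.
have UU' : U^T *m U = 1%:M := mulmx1C UU.
set Z := _ - _; pose Q := V^T *m U.
have QE i : (nu 0 j - mu 0 i) * Q i j = (V^T *m Z *m U) i j.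
  rewrite /Z mulmxBr mulmxBl !mulmxA VV' mul1mx -!mulmxA UU' mulmx1.
  rewrite mulmxA -/Q mul_diag_mx mul_mx_diag.
  by rewrite !mxE; move: (Q i j) => q; rewrite mulrBl mulrC.
have QQ : Q^T *m Q = 1%:M.
  by rewrite /Q trmx_mul trmxK mulmxA -(mulmxA _ V) VV mulmx1 UU'.
have Q1 : `|Q| <= 1.
  by rewrite -mx_norm_tr; apply: orthogonal_mx_norm; rewrite trmxK.
have ZZ : `|V^T *m Z *m U| <= n%:R ^+ 2 * `|Z|.
  have V1 : `|V^T| <= 1 by rewrite mx_norm_tr; exact: orthogonal_mx_norm.
  rewrite (_ : _ ^+ 2 * _ = n%:R * (n%:R * 1 * `|Z|) * 1); last by ring.
  by apply: mx_norm_mul_le; [exact: mx_norm_mul_le | exact: orthogonal_mx_norm].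
have n0 : 0 < n%:R :> R by rewrite ltr0n (leq_ltn_trans _ (ltn_ord j)).
have [i Qi] : exists i, n%:R^-1 <= `|Q i j|.
  apply: contrapT => /forallNP H.
  have : (Q^T *m Q) j j < 1; last by rewrite QQ mxE eqxx ltxx.
  rewrite mxE; apply: (@lt_le_trans _ _ (\sum_(k < n) n%:R^-1)); last first.
    by rewrite sumr_const card_ord -[leLHS]mulr_natr mulVf // gt_eqF.
  apply: ltr_sum => [|k _]; first by apply/hasP; exists j; rewrite ?mem_index_enum.
  rewrite mxE -expr2 -[X in X < _]ger0_norm ?sqr_ge0 // normrX.
  have /negP := H k; rewrite -ltNge; apply: le_lt_trans.
  rewrite expr2 ler_piMl //; apply: le_trans Q1; exact: le_mx_norm.
exists i; have := le_trans (le_mx_norm (V^T *m Z *m U) i j) ZZ.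
rewrite -QE normrM => H.
rewrite exprSr -mulrA [n%:R * _]mulrC mulrA -ler_pdivrMr //.
by apply: le_trans H; rewrite ler_wpM2l.
Qed.

End SymmetricSpectrum.

(** * The derivatives of a spectral function *)

Section SymmetricPart.
Variables (R : realType) (n : nat).
Implicit Types M : 'M[R]_n.

Lemma sympart_subproof M : 2^-1 *: (M + M^T) \in @symmx R n.
Proof. by rewrite unfold_in linearZ linearD /= trmxK addrC. Qed.

(** Linear, of norm at most one and the identity on symmetric matrices: estimates
for general matrices pass through it to the space of symmetric ones, and
pairings with symmetric matrices only see this part ([mxtrace_sympart]). *)
Definition sympart M : sym R n := Defs.Sym (sympart_subproof M).

Lemma sympart_linear (a : R) M M' :
  sympart (a *: M + M') = a *: sympart M + sympart M'.
Proof.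
by apply: val_inj; apply/matrixP => i j; rewrite !mxE; ring.
Qed.

Lemma sympartB M M' : sympart (M - M') = sympart M - sympart M'.
Proof.
by rewrite addrC -scaleN1r sympart_linear scaleN1r addrC.
Qed.

Lemma sympart_id (A : sym R n) : sympart (symval A) = A.
Proof.
have AT : (symval A)^T = symval A by apply/eqP; case: A.
by apply: val_inj; rewrite /= AT; apply/matrixP => i j; rewrite !mxE; field.
Qed.

Lemma sympart_norm M : `|sympart M| <= `|M|.
Proof.
rewrite -[leLHS]/(`|2^-1 *: (M + M^T)|) normrZ gtr0_norm ?invr_gt0 //.
rewrite mulrC ler_pdivrMr // mulr_natr mulr2n.
by apply: le_trans (ler_normD _ _) _; rewrite mx_norm_tr.
Qed.

Lemma symval_norm (A : sym R n) : `|symval A| = `|A|. Proof. by []. Qed.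

Lemma symvalB (A B : sym R n) : symval (A - B) = symval A - symval B.
Proof. by []. Qed.

Lemma symval_linear (a : R) (A B : sym R n) :
  symval (a *: A + B) = a *: symval A + symval B.
Proof. by []. Qed.

End SymmetricPart.

(** Finitely many local radii have a common value. *)
Lemma finite_radius (R : realType) (T : finType) (P : T -> R -> Prop) :
  (forall t d d', 0 < d' -> d' <= d -> P t d -> P t d') ->
  (forall t, exists2 d, 0 < d & P t d) -> exists2 d, 0 < d & forall t, P t d.
Proof.
move=> Pmono Pex; suff [d d0 H] : exists2 d, 0 < d & forall t, t \in enum T -> P t d.
  by exists d => // t; apply: H; rewrite mem_enum.
elim: (enum T) => [|t s [d d0 H]]; first by exists 1.
have [d' d'0 H'] := Pex t; have m0 : 0 < Num.min d d' by rewrite lt_min d0.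
exists (Num.min d d') => // u; rewrite inE => /orP[/eqP ->|us].
  by apply: Pmono H' => //; rewrite ge_min lexx orbT.
by apply: Pmono (H u us) => //; rewrite ge_min lexx.
Qed.

Lemma mul_div_add1_le (R : realType) (a b : R) : 0 <= a -> 0 <= b ->
  a * (b / (a + 1)) <= b.
Proof.
move=> a0 b0; have a1 : 0 < a + 1 by rewrite ltr_wpDl.
by rewrite mulrA ler_pdivrMr // mulrC ler_wpM2l // lerDl.
Qed.

Lemma near_normed_dist (R : realType) (W : normedModType R) (x : W) (e : R) :
  0 < e -> \forall y \near x, `|y - x| < e.
Proof.
move=> e0; have := nbhsx_ballx x e e0; rewrite -ball_normE.
by apply: filterS => y /=; rewrite distrC.
Qed.

Lemma near_normed_scale (R : realType) (W : normedModType R) (x : W) (K q : R) :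
  0 <= K -> 0 < q -> \forall y \near x, K * `|y - x| < q.
Proof.
move=> K0 q0; have K1 : 0 < K + 1 by rewrite ltr_wpDl.
apply: filterS (near_normed_dist x (divr_gt0 q0 K1)) => y.
rewrite ltr_pdivlMr // mulrC => H; apply: le_lt_trans H.
by rewrite ler_wpM2r // lerDl.
Qed.

Section Nabla.
Variables (R : realType) (n : nat) (I : set R).
Hypotheses (hI : is_interval I).
Implicit Types (X Y Z : sym R n) (V : 'M[R]_n) (F : nat -> R -> R).
Implicit Types (s : seq 'M[R]_n) (c : seq R) (k : nat).
Local Notation D := (@spectral_dom R n I).

Definition spectrum X : set R := range (lambda X 0).

Definition conj_word F X V s : 'M[R]_n :=
  V *m word_mx F (lambda X) [seq V^T *m H *m V | H <- s] *m V^T.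

Lemma conj_word_ncpoly F X V s c : is_diagonalizer X V ->
  jets_agree (size s).+1 (spectrum X) F (poly_jet (Poly c)) ->
  conj_word F X V s = ncpoly c X s.
Proof. by move=> [VV XE] H; rewrite [in RHS]XE; exact: word_ncpoly. Qed.

Lemma spectral_interpolation F X m :
  exists c, jets_agree m (spectrum X) F (poly_jet (Poly c)).
Proof.
have [p Hp] := interpolate_on [seq lambda X 0 i | i <- enum 'I_n] m F.
exists p => i x im [j _ <-]; rewrite polyseqK Hp //=.
by apply: map_f; rewrite mem_enum.
Qed.

(** The eigenbasis is a choice; the value is the same for all of them, by
[nabla_word_any]. *)
Definition nabla_word F X s := conj_word F X (diagonalizer X) s.

Lemma nabla_word_ncpoly F X s c :
  jets_agree (size s).+1 (spectrum X) F (poly_jet (Poly c)) ->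
  nabla_word F X s = ncpoly c X s.
Proof. exact: conj_word_ncpoly (diagonalizerP X). Qed.

Lemma nabla_word_any F X V s : is_diagonalizer X V ->
  nabla_word F X s = conj_word F X V s.
Proof.
move=> XV; have [c Hc] := spectral_interpolation F X (size s).+1.
by rewrite (nabla_word_ncpoly Hc) (conj_word_ncpoly XV Hc).
Qed.

Definition perm_seq k (h : 'I_k -> sym R n) (p : 'S_k) : seq 'M[R]_n :=
  [seq symval (h (p i)) | i <- enum 'I_k].

Lemma size_perm_seq k (h : 'I_k -> sym R n) p : size (perm_seq h p) = k.
Proof. by rewrite size_map size_enum_ord. Qed.

Lemma norm_prod_perm_seq k (h : 'I_k -> sym R n) p :
  norm_prod (perm_seq h p) = \prod_i `|h i|.
Proof.
rewrite /norm_prod big_map big_enum /= [RHS](reindex_inj (@perm_inj _ p)) /=.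
by [].
Qed.

(** Candidate for the [k]-th derivative: all orderings of the directions count. *)
Definition nabla k F X (h : 'I_k -> sym R n) : sym R n :=
  sympart (\sum_p nabla_word F X (perm_seq h p)).

Lemma perm_seq_upd k (h : 'I_k -> sym R n) i p : exists s1 s2, forall A,
  perm_seq (upd h i A) p = s1 ++ symval A :: s2.
Proof.
pose j := (p^-1)%g i; have pj : p j = i by rewrite permKV.
have jk : j \in enum 'I_k by rewrite mem_enum.
have := enum_uniq 'I_k; rewrite /perm_seq; case/path.splitPr: jk => e1 e2.
rewrite uniq_catC /= mem_cat negb_or => /andP[/andP[j2 j1] _].
exists [seq symval (h (p r)) | r <- e1], [seq symval (h (p r)) | r <- e2] => A.
have H e : j \notin e -> [seq symval (upd h i A (p r)) | r <- e] =
    [seq symval (h (p r)) | r <- e].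
  move=> je; apply/eq_in_map => r re; rewrite /upd -pj (inj_eq perm_inj).
  by case: eqVneq re je => [-> ->|].
by rewrite map_cat /= !H // /upd pj eqxx.
Qed.

Lemma nabla_bounded_multilinear k F X : bounded_multilinear (@nabla k F X).
Proof.
have [c Hc] := spectral_interpolation F X k.+1.
have nE (h : 'I_k -> sym R n) p : nabla_word F X (perm_seq h p) = ncpoly c X (perm_seq h p).
  by apply: nabla_word_ncpoly; rewrite size_perm_seq.
split.
  move=> h i a u v; rewrite /nabla -sympart_linear; congr sympart.
  rewrite scaler_sumr -big_split; apply: eq_bigr => p _; rewrite !nE /=.
  have [s1 [s2 H]] := perm_seq_upd h i p.
  by rewrite !H symval_linear ncpoly_linear.
have [C C0 HC] := @ncpoly_bound R n c `|symval X| k (normr_ge0 _).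
exists (#|{: 'S_k}|%:R * C) => h; apply: le_trans (sympart_norm _) _.
apply: le_trans (ler_norm_sum _ _ _) _.
have -> : #|{: 'S_k}|%:R * C * \prod_(i < k) `|h i| = \sum_(p : 'S_k) C * \prod_(i < k) `|h i|.
  by rewrite sumr_const -[RHS]mulr_natl mulrA.
apply: ler_sum => p _; rewrite nE -(norm_prod_perm_seq h p).
by apply: HC => //; exact: size_perm_seq.
Qed.

Lemma sum_perm_seq_snoc k (f : seq 'M[R]_n -> 'M[R]_n) (h : 'I_k -> sym R n) Z :
  \sum_p f (perm_seq (snoc h Z) p) =
  \sum_p \sum_(j < k.+1) f (insert_at j (symval Z) (perm_seq h p)).
Proof.
rewrite (sum_lift_perm ord_max) exchange_big; apply: eq_bigr => p _.
apply: eq_bigr => j _; congr f; rewrite /perm_seq.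
rewrite (map_comp (@symval R n)) map_snoc_lift_perm.
rewrite (map_comp (@symval R n) (fun i => h (p i))).
by rewrite /insert_at map_cat /= map_take map_drop.
Qed.

Definition near_spectrum X r : set R :=
  [set x | I x /\ exists i, `|x - lambda X 0 i| <= r].

(** The radius is a third of the smallest gap between distinct eigenvalues. *)
Lemma near_spectrum_locally_convex X : exists2 d, 0 < d &
  forall r, r <= d -> locally_convex I d (near_spectrum X r).
Proof.
pose P (p : 'I_n * 'I_n) d := lambda X 0 p.1 != lambda X 0 p.2 ->
  3 * d <= `|lambda X 0 p.1 - lambda X 0 p.2|.
have [||d d0 H] := @finite_radius R _ P.
- move=> t d d' _ dd' H /H; lra.
- move=> t; case: (eqVneq (lambda X 0 t.1) (lambda X 0 t.2)) => [e|ne].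
    by exists 1 => //; rewrite /P e eqxx.
  exists (`|lambda X 0 t.1 - lambda X 0 t.2| / 3).
    by rewrite divr_gt0 // normr_gt0 subr_eq0.
  by rewrite /P; lra.
exists d => // r rd; split; first by move=> x [].
move=> a x t [Ia [i ai]] [Ix [j xj]] xa tb.
have ij : lambda X 0 i = lambda X 0 j.
  apply/eqP; apply: contraLR isT => /(H (i, j)) /=.
  have -> : lambda X 0 i - lambda X 0 j =
    - (a - lambda X 0 i) - (x - a) + (x - lambda X 0 j) by ring.
  have := ler_normD (- (a - lambda X 0 i) - (x - a)) (x - lambda X 0 j).
  have := ler_normB (- (a - lambda X 0 i)) (x - a).
  rewrite normrN; lra.
split; first exact: strictly_between_in tb.
exists i; rewrite -ij in xj.
move: ai xj tb; rewrite /strictly_between !ler_norml => /andP[h1 h2] /andP[h3 h4].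
by case/orP => /andP[h5 h6]; apply/andP; split; lra.
Qed.

Lemma spectrum_variation_sym X Y V U j : is_diagonalizer X V ->
  is_diagonalizer Y U ->
  exists i, `|lambda Y 0 j - lambda X 0 i| <= n%:R ^+ 3 * `|Y - X|.
Proof.
move=> [VV XE] [UU YE]; move: (lambda X) (lambda Y) XE YE => mu nu XE YE.
have [i Hi] := spectrum_variation mu nu j VV UU.
by exists i; move: Hi; rewrite -XE -YE.
Qed.

(** If [F] and its derivatives up to order [k] are small near the spectrum of
[X], then so are its words of length [k] at all [Y] close to [X], because the
eigenvalues of [Y] are near those of [X]. *)
Lemma nabla_word_small X k : exists d C K, [/\ 0 < d, 0 <= C, 0 <= K &
  forall r F B Y s, r <= d -> tower I k F -> 0 <= B ->
    jet_bound k (near_spectrum X r) B F -> D Y -> K * `|Y - X| <= r ->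
    size s = k -> `|nabla_word F Y s| <= C * B * norm_prod s].
Proof.
have [d d0 Hd] := near_spectrum_locally_convex X.
have [C C0 HC] := @word_small R n I d k hI d0.
exists d, (n%:R ^+ 2 * C * (n%:R ^+ 2) ^+ k), (n%:R ^+ 3); split=> //.
- by rewrite !mulr_ge0 // !exprn_ge0.
move=> r F B Y s rd tF B0 HB DY Yr sk.
have [VV _] := diagonalizerP Y.
set V := diagonalizer Y in VV *.
have VV' : V^T *m V^T^T = 1%:M by rewrite trmxK; exact: mulmx1C VV.
apply: le_trans (orthogonal_conj_norm _ VV) _.
have np : norm_prod [seq V^T *m H *m V | H <- s] <= (n%:R ^+ 2) ^+ k * norm_prod s.
  rewrite -sk; elim: (s) => [|H s' IH] /=; first by rewrite /norm_prod !big_nil mul1r.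
  rewrite !norm_prod_cons exprS mulrACA.
  apply: ler_pM => //; first exact: norm_prod_ge0.
  by have := orthogonal_conj_norm H VV'; rewrite trmxK.
rewrite [leRHS](_ : _ = n%:R ^+ 2 * (C * B * ((n%:R ^+ 2) ^+ k * norm_prod s))); last by ring.
rewrite ler_wpM2l ?exprn_ge0 //.
apply: mx_norm_le => [|i j].
  by rewrite !mulr_ge0 ?exprn_ge0 // norm_prod_ge0.
rewrite mxE; apply: (@le_trans _ _ (C * B * norm_prod [seq V^T *m H *m V | H <- s])).
  apply: (HC (near_spectrum X r)) => //; [exact: Hd | | by rewrite size_map].
  move=> l; split; first exact: DY.
  have [m Hm] := spectrum_variation_sym l (diagonalizerP X) (diagonalizerP Y).
  by exists m; exact: le_trans Hm Yr.
by rewrite ler_wpM2l // mulr_ge0.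
Qed.

Lemma nabla_word_split F Y c s :
  nabla_word F Y s =
  nabla_word (fun i x => F i x - poly_jet (Poly c) i x) Y s + ncpoly c Y s.
Proof.
have <- : nabla_word (poly_jet (Poly c)) Y s = ncpoly c Y s.
  exact: nabla_word_ncpoly.
rewrite /nabla_word /conj_word -mulmxDl -mulmxDr; congr (_ *m _ *m _).
apply/matrixP => i j; rewrite !mxE.
have := word_linear 1 (fun m x => F m x - poly_jet (Poly c) m x)
  (poly_jet (Poly c)) (lambda Y) [seq (diagonalizer Y)^T *m H *m diagonalizer Y | H <- s] i j.
rewrite mul1r => <-; congr word; apply/funext => m; apply/funext => x.
by rewrite mul1r subrK.
Qed.

(** Split [F] into an interpolant of order [k.+1] on the spectrum of [X] and a
remainder [E].  The interpolant is expanded by [ncpoly_taylor].  For [E] the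
derivatives up to order [k.+1] vanish on the spectrum, so those up to order
[k] are [o] of the distance to it, and [nabla_word_small] bounds the words of
[E] at [Y]; at [X] they vanish. *)
Lemma nabla_word_taylor X k F e : D X -> tower I k.+1 F -> 0 < e ->
  \forall Y \near X, D Y -> forall s, size s = k ->
    `|nabla_word F Y s - nabla_word F X s -
      \sum_(j < k.+1) nabla_word F X (insert_at j (symval (Y - X)) s)| <=
    e * `|Y - X| * norm_prod s.
Proof.
move=> DX tF e0; have [c Hc] := spectral_interpolation F X k.+2.
pose E i x := F i x - poly_jet (Poly c) i x.
have tE : tower I k.+1 E by apply: towerB => //; exact: tower_poly_jet.
have E0 i a : (i < k.+2)%N -> E i (lambda X 0 a) = 0.
  by move=> ik; rewrite /E Hc ?subrr //; exists a.
have [d [C [K [d0 C0 K0 Hsmall]]]] := nabla_word_small X k.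
have r0 : 0 <= `|symval X| + 1 by rewrite addr_ge0.
have [T T0 HT] := @ncpoly_taylor R n c _ k r0.
pose eps := e / 2 / (C * K + 1).
have CK0 : 0 < C * K + 1 by rewrite ltr_wpDl ?mulr_ge0.
have eps0 : 0 < eps by rewrite !divr_gt0.
pose P (t : 'I_k.+1 * 'I_n) d' := forall x, I x -> `|x - lambda X 0 t.2| < d' ->
  `|E t.1 x| <= eps * `|x - lambda X 0 t.2|.
have [||d' d'0 Hd'] := @finite_radius R _ P.
- move=> t a b _ ba H x Ix xt; apply: H => //; exact: lt_le_trans ba.
- move=> [i a]; have := tE i (lambda X 0 a) (ltn_ord i) (DX a) eps eps0.
  move=> /nbhs_ballP[b /= b0 Hb]; exists b => // x Ix xb.
  have := Hb x; rewrite /ball /= distrC => /(_ xb Ix).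
  have ik := ltn_ord i; have E1 : E i.+1 (lambda X 0 a) = 0 by apply: E0; rewrite ltnS.
  by rewrite E1 (E0 i a (ltnW ik)) mul0r !subr0.
near=> Y => DY s sk.
have Y1 : `|Y - X| < 1 by near: Y; exact: near_normed_dist.
have Yd : K * `|Y - X| < d by near: Y; exact: near_normed_scale.
have Yd' : K * `|Y - X| < d' by near: Y; exact: near_normed_scale.
have YT : T * `|Y - X| < e / 2 by near: Y; apply: near_normed_scale => //; rewrite divr_gt0.
set t := `|Y - X| in Y1 Yd Yd' YT *; have t0 : 0 <= t by exact: normr_ge0.
have HE : jet_bound k (near_spectrum X (K * t)) (eps * (K * t)) E.
  move=> i x ik [Ix [a xa]]; have ik' : (i < k.+1)%N by rewrite ltnS.
  apply: le_trans (Hd' (Ordinal ik', a) x Ix (le_lt_trans xa Yd')) _.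
  by rewrite ler_pM2l.
have B0 : 0 <= eps * (K * t) by apply: mulr_ge0; [exact: ltW | exact: mulr_ge0].
have := Hsmall _ _ _ _ _ (ltW Yd) (towerW (leqnSn k) tE) B0 HE DY (lexx _) sk.
have := HT (symval X) (symval Y) s _ _ sk; rewrite -symvalB symval_norm.
have Xr : `|symval X| <= `|symval X| + 1 by rewrite lerDl.
have Yr : `|symval Y| <= `|symval X| + 1.
  rewrite (_ : symval Y = symval X + symval (Y - X)); last by rewrite symvalB addrC subrK.
  by apply: le_trans (ler_normD _ _) _; rewrite lerD2l ltW.
move=> /(_ Xr Yr) H1 H2.
rewrite (nabla_word_split F Y c) -/E (@nabla_word_ncpoly F X s c); last first.
  by move=> i x im; apply: Hc; rewrite sk in im; exact: leqW.
rewrite [X in _ - _ - X](_ : _ = \sum_(j < k.+1) ncpoly c X (insert_at j (symval (Y - X)) s)); last first.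
  by apply: eq_bigr => j _; apply: nabla_word_ncpoly; rewrite size_insert_at sk.
rewrite -addrA -addrA; apply: le_trans (ler_normD _ _) _; rewrite addrA.
apply: le_trans (lerD H2 H1) _; rewrite -mulrDl ler_wpM2r ?norm_prod_ge0 //.
rewrite -/t [in leRHS](splitr e) mulrDl; apply: lerD.
  rewrite (_ : C * (eps * (K * t)) = (C * K * eps) * t); last by ring.
  by rewrite ler_wpM2r // mul_div_add1_le ?mulr_ge0 // ltW.
by rewrite expr2 mulrA ler_wpM2r // ltW.
Unshelve. all: by end_near. Qed.

(** The same splitting with an interpolant of order [k]; the remainder is now
only known to be continuous and zero on the spectrum. *)
Lemma nabla_word_cont X k F e : D X -> tower I k F ->
  (forall a, I a -> forall q, 0 < q ->
     \forall x \near a, I x -> `|F k x - F k a| <= q) -> 0 < e ->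
  \forall Y \near X, D Y -> forall s, size s = k ->
    `|nabla_word F Y s - nabla_word F X s| <= e * norm_prod s.
Proof.
move=> DX tF cF e0; have [c Hc] := spectral_interpolation F X k.+1.
pose E i x := F i x - poly_jet (Poly c) i x.
have tE : tower I k E by apply: towerB => //; exact: tower_poly_jet.
have E0 i a : (i < k.+1)%N -> E i (lambda X 0 a) = 0.
  by move=> ik; rewrite /E Hc ?subrr //; exists a.
have cE i a : (i < k.+1)%N -> I a -> forall q, 0 < q ->
    \forall x \near a, I x -> `|E i x - E i a| <= q.
  rewrite ltnS leq_eqVlt => /orP[/eqP ->|ik] Ia q q0; last exact: has_deriv_cont (tE i a ik Ia) q q0.
  have q2 : 0 < q / 2 by rewrite divr_gt0.
  have := @has_deriv_cont R I _ _ _ (@tower_poly_jet R I k.+1 (Poly c) k a (leqnn _) Ia) _ q2.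
  apply: filterS2 (cF a Ia _ q2) => x H1 H2 Ix.
  rewrite /E (_ : _ - _ - _ = (F k x - F k a) - (poly_jet (Poly c) k x - poly_jet (Poly c) k a)); last by ring.
  apply: le_trans (ler_normB _ _) _; rewrite (splitr q).
  by apply: lerD; [exact: H1 | exact: H2].
have [d [C [K [d0 C0 K0 Hsmall]]]] := nabla_word_small X k.
have r0 : 0 <= `|symval X| + 1 by rewrite addr_ge0.
have [T T0 HT] := @ncpoly_lipschitz R n c _ k r0.
pose eps := e / 2 / (C + 1).
have C1 : 0 < C + 1 by rewrite ltr_wpDl.
have eps0 : 0 < eps by rewrite !divr_gt0.
pose P (t : 'I_k.+1 * 'I_n) d' := forall x, I x -> `|x - lambda X 0 t.2| < d' ->
  `|E t.1 x| <= eps.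
have [||d' d'0 Hd'] := @finite_radius R _ P.
- move=> t a b _ ba H x Ix xt; apply: H => //; exact: lt_le_trans ba.
- move=> [i a]; have := cE i (lambda X 0 a) (ltn_ord i) (DX a) eps eps0.
  move=> /nbhs_ballP[b /= b0 Hb]; exists b => // x Ix xb.
  have := Hb x; rewrite /ball /= distrC => /(_ xb Ix).
  by rewrite (E0 i) ?subr0.
near=> Y => DY s sk.
have Y1 : `|Y - X| < 1 by near: Y; exact: near_normed_dist.
have Yd : K * `|Y - X| < d by near: Y; exact: near_normed_scale.
have Yd' : K * `|Y - X| < d' by near: Y; exact: near_normed_scale.
have YT : T * `|Y - X| < e / 2 by near: Y; apply: near_normed_scale => //; rewrite divr_gt0.
set t := `|Y - X| in Y1 Yd Yd' YT *; have t0 : 0 <= t by exact: normr_ge0.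
have HE : jet_bound k (near_spectrum X (K * t)) eps E.
  move=> i x ik [Ix [a xa]]; have ik' : (i < k.+1)%N by rewrite ltnS.
  exact: (Hd' (Ordinal ik', a) x Ix (le_lt_trans xa Yd')).
have := Hsmall _ _ _ _ _ (ltW Yd) tE (ltW eps0) HE DY (lexx _) sk.
have := HT (symval X) (symval Y) s _ _ sk; rewrite -symvalB symval_norm.
have Xr : `|symval X| <= `|symval X| + 1 by rewrite lerDl.
have Yr : `|symval Y| <= `|symval X| + 1.
  rewrite (_ : symval Y = symval X + symval (Y - X)); last by rewrite symvalB addrC subrK.
  by apply: le_trans (ler_normD _ _) _; rewrite lerD2l ltW.
move=> /(_ Xr Yr) H1 H2.
rewrite (nabla_word_split F Y c) -/E (@nabla_word_ncpoly F X s c); last first.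
  by rewrite sk.
rewrite -addrA; apply: le_trans (ler_normD _ _) _.
apply: le_trans (lerD H2 H1) _; rewrite -mulrDl ler_wpM2r ?norm_prod_ge0 //.
rewrite -/t (splitr e); apply: lerD; last exact: ltW.
by rewrite mul_div_add1_le // divr_ge0 // ltW.
Unshelve. all: by end_near. Qed.

Lemma nabla_frechet X k F : D X -> tower I k.+1 F ->
  is_frechet_derivative D (fun Y => @nabla k F Y) X (@nabla k.+1 F X).
Proof.
move=> DX tF; split=> [|e e0]; first exact: nabla_bounded_multilinear.
pose q : R := #|{: 'S_k}|%:R.
have q0 : 0 < q by rewrite ltr0n; apply/card_gt0P; exists 1%g.
have eq0 : 0 < e / q by rewrite divr_gt0.
apply: filterS (nabla_word_taylor DX tF eq0) => Y HY DY h.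
rewrite /nabla sum_perm_seq_snoc -!sympartB; apply: le_trans (sympart_norm _) _.
rewrite -!sumrB; apply: le_trans (ler_norm_sum _ _ _) _.
have -> : e * `|Y - X| * \prod_(i < k) `|h i| =
    \sum_(p : 'S_k) e / q * `|Y - X| * norm_prod (perm_seq h p).
  rewrite [RHS](eq_bigr (fun=> e / q * `|Y - X| * \prod_(i < k) `|h i|)) => [|p _]; last first.
    by rewrite norm_prod_perm_seq.
  rewrite sumr_const -[RHS]mulr_natl -/q !mulrA; congr (_ * _ * _).
  by field; rewrite gt_eqF.
by apply: ler_sum => p _; apply: HY => //; exact: size_perm_seq.
Qed.

Lemma nabla_continuous X k F : D X -> tower I k F ->
  (forall a, I a -> forall q, 0 < q ->
     \forall x \near a, I x -> `|F k x - F k a| <= q) ->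
  Defs.continuous_at D (fun Y => @nabla k F Y) X.
Proof.
move=> DX tF cF e e0.
pose q : R := #|{: 'S_k}|%:R.
have q0 : 0 < q by rewrite ltr0n; apply/card_gt0P; exists 1%g.
have eq0 : 0 < e / q by rewrite divr_gt0.
apply: filterS (nabla_word_cont DX tF cF eq0) => Y HY DY h.
rewrite /nabla -!sympartB; apply: le_trans (sympart_norm _) _.
rewrite -!sumrB; apply: le_trans (ler_norm_sum _ _ _) _.
have -> : e * \prod_(i < k) `|h i| =
    \sum_(p : 'S_k) e / q * norm_prod (perm_seq h p).
  rewrite [RHS](eq_bigr (fun=> e / q * \prod_(i < k) `|h i|)) => [|p _]; last first.
    by rewrite norm_prod_perm_seq.
  rewrite sumr_const -[RHS]mulr_natl -/q !mulrA; congr (_ * _).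
  by field; rewrite gt_eqF.
by apply: ler_sum => p _; apply: HY => //; exact: size_perm_seq.
Qed.

(** The [k]-th derivative has its formula at every point of the domain, so the
next one is a Frechet derivative of this formula. *)
Lemma nabla_is_nabla X k F : D X -> tower I k F ->
  is_nabla D (spectral_fun (F 0%N)) X (@nabla k F X).
Proof.
elim: k X => [|k IH] X DX tF.
  move=> h; rewrite /nabla.
  have -> : \sum_(p : 'S_0) nabla_word F X (perm_seq h p) =
      symval (spectral_fun (F 0%N) X).
    rewrite (bigD1 1%g) //= big1 ?addr0 => [|p]; last first.
      by case/eqP; apply/permP => -[].
    rewrite /perm_seq (size0nil (size_enum_ord 0)) /nabla_word /conj_word /=.
    congr (_ *m _ *m _); apply/matrixP => i j; rewrite !mxE /=.
    by case: eqVneq => [->|]; rewrite ?mulr1n ?mulr0n.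
  exact: sympart_id.
exists (fun Y => @nabla k F Y); split; last exact: nabla_frechet.
apply: (@filterE _ (nbhs X)) => Y DY.
by apply: IH => //; exact: towerW tF.
Qed.

End Nabla.

(** * Recursive divided differences and cycles *)

Lemma enum_ord_lift_max n :
  enum 'I_n.+1 = rcons [seq lift ord_max i | i <- enum 'I_n] ord_max.
Proof.
rewrite enum_ordSr; congr rcons; apply: eq_map => i; apply: val_inj.
by rewrite /= /bump leqNgt ltn_ord.
Qed.

Lemma map_upd (T : Type) k (h : 'I_k -> T) (l : 'I_k) : exists s1 s2, forall u,
  [seq upd h l u i | i <- enum 'I_k] = s1 ++ u :: s2.
Proof.
have lk : l \in enum 'I_k by rewrite mem_enum.
have := enum_uniq 'I_k; case/path.splitPr: lk => e1 e2.
rewrite uniq_catC /= mem_cat negb_or => /andP[/andP[l2 l1] _].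
exists [seq h r | r <- e1], [seq h r | r <- e2] => u.
have H e : l \notin e -> [seq upd h l u r | r <- e] = [seq h r | r <- e].
  by move=> le; apply/eq_in_map => r re; rewrite /upd; case: eqVneq re le => [-> ->|].
by rewrite map_cat /= !H // /upd eqxx.
Qed.

Lemma perm_cat_rcons (T : eqType) (s1 s2 : seq T) x :
  perm_eq (s1 ++ x :: s2) (rcons (s1 ++ s2) x).
Proof. by rewrite -cats1 -catA perm_cat2l cats1 perm_sym perm_rcons. Qed.

Section DividedDifferencesAreSymmetric.
Variables (R : realType) (I : set R) (g : R -> R).
Hypotheses (hI : is_interval I) (hI0 : I° !=set0).
Let F i := iter i (derive_on I) g.

Lemma tower_foldl m s (E : nat -> R -> R) : (forall x, x \in s -> I x) ->
  tower I (m + size s) E -> tower I m (foldl (fun E b => dq b E) E s).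
Proof.
elim: s E => [|b s IH] E Is; first by rewrite addn0.
rewrite /= addnS => tE; apply: IH => [x xs|]; first by apply: Is; rewrite inE xs orbT.
by apply: tower_dq => //; apply: Is; rewrite mem_head.
Qed.

(** The recursion along [t] extends the list of points by one, taking a
difference quotient in the slot [l].  By symmetry the slot can be moved to
the end, where the quotient is [dq]; on the diagonal, the derivative in the
slot is the one recorded in the tower.  The value does not depend on [t]. *)
Lemma div_diff_dd s (t : 'S_s.+2) (x : 'I_s.+2 -> R) : one_cycle t ->
  tower I s.+1 F -> (forall i, I (x i)) ->
  div_diff I g t x = dd F [seq x i | i <- enum 'I_s.+2].
Proof.
elim: s t x => [|s IH] t x ct tF Ix.
  rewrite enum_ord_lift_max map_rcons -dd_cons_rcons enum_ordSl (size0nil (size_enum_ord 0)) /=.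
  have -> : lift ord_max ord0 = ord0 :> 'I_2 by apply: val_inj.
  by rewrite /F /= divr1 eq_sym; case: eqVneq => [->|].
have [t' [l [ct' ->]]] := one_cycle_insert ct.
rewrite div_diff_insert //; set z := x ord_max.
pose y (i : 'I_s.+2) := x (lift ord_max i); rewrite -/y -/(y l).
have [s1 [s2 Hs]] := map_upd y l.
have updl : upd y l (y l) = y.
  by apply/funext => i; rewrite /upd; case: eqVneq => [->|].
have yE : [seq y i | i <- enum 'I_s.+2] = s1 ++ y l :: s2 by rewrite -Hs updl.
have Iy a : a \in s1 ++ s2 -> I a.
  move=> as12; have : a \in s1 ++ y l :: s2.
    by move: as12; rewrite !mem_cat inE; case/orP => ->; rewrite ?orbT.
  by rewrite -yE => /mapP[i _ ->]; exact: Ix.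
(* the jet, in the slot l, of the divided difference with the other points fixed *)
pose E := foldl (fun E b => dq b E) F (s1 ++ s2).
have tE : tower I 1 E.
  apply: tower_foldl => //; have := congr1 size yE.
  by rewrite size_map size_enum_ord !size_cat /= addnS => -[<-]; rewrite add1n.
have updE u : I u -> div_diff I g t' (upd y l u) = E 0%N u.
  move=> Iu; rewrite (IH _ _ ct' (towerW (leqnSn _) tF)).
    by rewrite Hs (dd_perm F (perm_cat_rcons s1 s2 u)) dd_rcons.
  by move=> i; rewrite /upd; case: ifP => // _; exact: Ix.
have xE : dd F [seq x i | i <- enum 'I_s.+3] = dq (y l) E 0%N z.
  rewrite enum_ord_lift_max map_rcons -map_comp -/z.
  rewrite -[[seq _ | i <- _]]/[seq y i | i <- enum 'I_s.+2] yE.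
  rewrite -cats1 (dd_perm F (s2 := rcons (rcons (s1 ++ s2) (y l)) z)).
    by rewrite dd_rcons -[in LHS]cats1 foldl_cat.
  by rewrite -cats1 perm_cat2r perm_cat_rcons.
rewrite xE; case: eqVneq => [<-|yz].
  rewrite dq_diag divr1; apply: derive_on_unique => //; first exact: Ix.
  apply: has_deriv_eq_near (tE 0%N (y l) isT (Ix _)).
    by rewrite updE //; exact: Ix.
  by apply: (@filterE _ (nbhs (y l))) => u Iu; rewrite updE.
have -> : div_diff I g t' y = E 0%N (y l) by rewrite -[in LHS]updl updE //; exact: Ix.
rewrite updE; last exact: Ix.
by rewrite dq_swap /= (negPf yz).
Qed.

End DividedDifferencesAreSymmetric.

Section CycleBijection.
Variable m : nat.
Implicit Types (s : 'S_m) (t : 'S_m.+1).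

Definition fix_last s : 'S_m.+1 := lift_perm ord_max ord_max s.

Definition succ_perm : 'S_m.+1 := perm (@ordS_inj m.+1).

(** The cycle whose inverse, started at the last point, visits [s 0], [s 1], ... in
this order. *)
Definition cycle_of s : 'S_m.+1 := ((succ_perm ^ fix_last s)^-1)%g.

Lemma cycle_ofVE s p : ((cycle_of s)^-1)%g (fix_last s p) = fix_last s (ordS p).
Proof.
rewrite /cycle_of invgK conjgE !permM permK /succ_perm.
by rewrite (permE (@ordS_inj m.+1)).
Qed.

Lemma cycle_of_orbit s (p : 'I_m.+1) :
  ((cycle_of s)^-1 ^+ p.+1)%g ord_max = fix_last s p.
Proof.
have maxE : fix_last s ord_max = ord_max by rewrite /fix_last lift_perm_id.
case: p => p; elim: p => [|p IH] pm /=.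
  rewrite expg1 -{1}maxE cycle_ofVE; congr (fix_last s _); apply: val_inj => /=.
  by rewrite modnn.
rewrite expgSr permM (IH (ltnW pm)) cycle_ofVE; congr (fix_last s _); apply: val_inj => /=.
by rewrite modn_small.
Qed.

Lemma cycle_of_one_cycle s : one_cycle (cycle_of s).
Proof.
apply/(one_cycleP _ ord_max) => y; rewrite -porbitV.
by rewrite -(permKV (fix_last s) y) -cycle_of_orbit mem_porbit.
Qed.

Lemma cycle_of_inj : injective cycle_of.
Proof.
move=> s s' e; apply: (@lift_perm_inj _ ord_max ord_max); apply/permP => p.
by rewrite -[LHS]cycle_of_orbit e cycle_of_orbit.
Qed.

Lemma cycle_of_surj t : one_cycle t -> exists s, t = cycle_of s.
Proof.
move=> ct; pose v := (t^-1)%g; pose x : 'I_m.+1 := ord_max.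
have full : #|porbit v x| = m.+1.
  rewrite -[RHS]card_ord; apply: eq_card => y; rewrite porbitV.
  by move/(one_cycleP _ x): ct => ->.
have vm : iter m.+1 v x = x by have := iter_porbit v x; rewrite full.
pose f (p : 'I_m.+1) := (v ^+ p.+1)%g x.
have f_inj : injective f.
  move=> p q; rewrite /f !expgSr !permM => /perm_inj; rewrite !permX => e.
  have := uniq_traject_porbit v x; rewrite full => U.
  apply: ord_inj; apply/eqP; rewrite -(nth_uniq x _ _ U) ?size_traject //.
  by rewrite !nth_traject // e.
have [|s sE] := @lift_perm_surj _ (perm f_inj) x x.
  by rewrite permE /f permX.
exists s; apply: invg_inj; apply/permP => y.
rewrite -(permKV (fix_last s) y); move: ((fix_last s)^-1 y)%g => p.
rewrite cycle_ofVE /fix_last -sE !(permE f_inj) /f -/v -permM -expgSr.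
case: (ltnP p m) => pm; first by rewrite /= modn_small.
have pE : p = x by apply: val_inj; apply/eqP; rewrite eqn_leq pm -ltnS ltn_ord.
by rewrite pE /= modnn expgSr permM [in LHS]permX vm expg1.
Qed.

(** A cycle is determined by the order in which its inverse visits the other
points when started at the last one. *)
Lemma sum_one_cycle (W : nmodType) (f : 'S_m.+1 -> W) :
  \sum_(t | one_cycle t) f t = \sum_s f (cycle_of s).
Proof.
have -> : \sum_s f (cycle_of s) = \sum_(s in predT) f (cycle_of s) by [].
rewrite -(big_imset f (h := cycle_of)) /=; last by move=> s s' _ _; exact: cycle_of_inj.
apply: eq_bigl => t; apply/idP/imsetP => [/cycle_of_surj[s ->]|[s _ ->]].
  by exists s.
exact: cycle_of_one_cycle.
Qed.

End CycleBijection.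

(** * Tensor contractions as traces of words *)

Section TraceFormula.
Variables (R : realType) (n : nat).
Implicit Types (F : nat -> R -> R) (mu : 'rV[R]_n) (V : 'M[R]_n).

Fixpoint path_prod (s : seq 'M[R]_n) (i : 'I_n) (w : seq 'I_n) : R :=
  if (s, w) is (A :: s', l :: w') then A i l * path_prod s' l w' else 1.

Lemma big_tuple_cons (T : finType) m (f : seq T -> R) :
  \sum_(w : m.+1.-tuple T) f w = \sum_l \sum_(w : m.-tuple T) f (l :: w).
Proof.
rewrite pair_big /=.
rewrite (reindex (fun p : T * m.-tuple T => [tuple of p.1 :: p.2])) //=.
exists (fun w : m.+1.-tuple T => (thead w, [tuple of behead w])) => [[l w] _|w _] /=.
  by rewrite theadE; congr pair; exact: val_inj.
by rewrite [RHS]tuple_eta; exact: val_inj.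
Qed.

Lemma word_path_sum F mu s m i (f : 'I_n -> R) : size s = m ->
  \sum_j word F mu s i j * f j =
  \sum_(w : m.-tuple 'I_n)
    dd F [seq mu 0 l | l <- i :: w] * path_prod s i w * f (last i w).
Proof.
move=> <-; elim: s F i => [|A s IH] F i /=.
  rewrite (bigD1 i) //= eqxx mulr1n big1 ?addr0 => [|j ji]; last first.
    by rewrite eq_sym (negPf ji) mulr0n mul0r.
  rewrite (big_pred1 [tuple]) => [|w]; first by rewrite /= mulr1.
  by apply/esym/eqP; exact: tuple0.
rewrite (big_tuple_cons _ (fun w => dd F [seq mu 0 l | l <- i :: w] *
  path_prod (A :: s) i w * f (last i w))).
transitivity (\sum_l A i l * \sum_j word (dq (mu 0 i) F) mu s l j * f j).
  under [RHS]eq_bigr do rewrite mulr_sumr.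
  rewrite exchange_big; apply: eq_bigr => j _ /=.
  by rewrite mulr_suml; apply: eq_bigr => l _; rewrite mulrA.
apply: eq_bigr => l _; rewrite IH mulr_sumr; apply: eq_bigr => w _ /=.
by ring.
Qed.

Lemma path_prod_rcons s K i w j : size w = size s ->
  path_prod (rcons s K) i (rcons w j) = path_prod s i w * K (last i w) j.
Proof.
elim: s i w => [|A s IH] i [|l w] //=; first by rewrite mulrC.
by case=> sz; rewrite IH // mulrA.
Qed.

Lemma path_prod_nth (A0 : 'M[R]_n) s i w : size w = size s ->
  path_prod s i w =
  \prod_(p < size s) nth A0 s p (nth i (i :: w) p) (nth i w p).
Proof.
elim: s i w => [|A s IH] i [|l w] //=; first by rewrite big_ord0.
case=> sz; rewrite big_ord_recl /= (IH l w sz); congr (_ * _).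
apply: eq_bigr => p _ /=; congr (nth A0 s p _ _).
  by apply: set_nth_default; rewrite /= sz ltnW // ltnS.
by apply: set_nth_default; rewrite sz.
Qed.

(** A closed path through the eigenbasis: the product along it has one factor for
each consecutive pair, cyclically. *)
Lemma trace_word F mu m (A : 'I_m.+1 -> 'M[R]_n) :
  \tr (word_mx F mu [seq A (lift ord_max p) | p <- enum 'I_m] *m A ord_max) =
  \sum_(v : {ffun 'I_m.+1 -> 'I_n})
    dd F [seq mu 0 (v p) | p <- enum 'I_m.+1] *
    \prod_p A p (v p) (v (ordS p)).
Proof.
set s := [seq _ | p <- _].
have sz : size s = m by rewrite size_map size_enum_ord.
transitivity (\sum_i \sum_(w : m.-tuple 'I_n)
    dd F [seq mu 0 l | l <- i :: w] * path_prod s i w * A ord_max (last i w) i).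
  apply: eq_bigr => i _; rewrite mxE -(word_path_sum F mu i (A ord_max ^~ i) sz).
  by apply: eq_bigr => j _; rewrite mxE.
rewrite -(big_tuple_cons _ (fun w => if w is i :: w' then
  dd F [seq mu 0 l | l <- w] * path_prod s i w' * A ord_max (last i w') i else 0)).
rewrite (reindex (fun v : {ffun 'I_m.+1 -> 'I_n} => [tuple v p | p < m.+1])) /=; last first.
  exists (fun w : m.+1.-tuple 'I_n => [ffun p => tnth w p]) => [v _|w _].
    by apply/ffunP => p; rewrite ffunE tnth_mktuple.
  by apply: eq_from_tnth => p; rewrite tnth_mktuple ffunE.
apply: eq_bigr => v _.
have -> : [tuple v p | p < m.+1] = [seq v p | p <- enum 'I_m.+1] :> seq 'I_n by [].
have szv : size [seq v p | p <- enum 'I_m.+1] = m.+1 by rewrite size_map size_enum_ord.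
have nthv i p : nth i [seq v p | p <- enum 'I_m.+1] (nat_of_ord p) = v p.
  by rewrite (nth_map p) ?size_enum_ord // nth_ord_enum.
have -> : [seq mu 0 (v p) | p <- enum 'I_m.+1] =
    [seq mu 0 l | l <- [seq v p | p <- enum 'I_m.+1]] by rewrite -map_comp.
move: szv nthv.
case: [seq v p | p <- _] => [//|i w] [szw] nthv.
rewrite -mulrA; congr (_ * _).
rewrite -path_prod_rcons ?sz // (path_prod_nth (A ord0)); last by rewrite !size_rcons szw sz.
rewrite size_rcons sz; apply: eq_bigr => p _.
have -> : nth (A ord0) (rcons s (A ord_max)) p = A p.
  have -> : rcons s (A ord_max) = [seq A q | q <- enum 'I_m.+1].
    by rewrite enum_ord_lift_max map_rcons -map_comp.
  by rewrite (nth_map p) ?size_enum_ord // nth_ord_enum.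
have -> : nth i (i :: rcons w i) p = v p.
  by rewrite -rcons_cons nth_rcons /= szw ltn_ord nthv.
congr (A p _ _); rewrite nth_rcons szw; case: ltngtP => pm.
- by rewrite -(nthv i (ordS p)) /= modn_small.
- by move: (ltn_ord p); rewrite ltnS leqNgt pm.
by rewrite -(nthv i (ordS p)) /= pm modnn.
Qed.

Lemma sum_upper_lower k (f : {ffun 'I_k -> 'I_n} -> {ffun 'I_k -> 'I_n} -> R) :
  \sum_(p : {ffun 'I_(k + k) -> 'I_n}) f (upper p) (lower p) = \sum_u \sum_l f u l.
Proof.
rewrite pair_big /=.
pose h (ul : {ffun 'I_k -> 'I_n} * {ffun 'I_k -> 'I_n}) : {ffun 'I_(k + k) -> 'I_n} :=
  [ffun r => match fintype.split r with inl a => ul.1 a | inr b => ul.2 b end].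
have hu ul : upper (h ul) = ul.1.
  by apply/ffunP => r; rewrite !ffunE (unsplitK (inl r)).
have hl ul : lower (h ul) = ul.2.
  by apply/ffunP => r; rewrite !ffunE (unsplitK (inr r)).
rewrite (reindex h) /=.
  by apply: eq_bigr => ul _; rewrite hu hl.
exists (fun p => (upper p, lower p)) => [[u l] _|p _]; first by rewrite hu hl.
apply/ffunP => r; rewrite !ffunE -[r in RHS]splitK.
by case: (fintype.split r) => a /=; rewrite ffunE.
Qed.

Lemma tensor_form_conj k (T : tensor R n (k + k)) V (H : 'I_k -> 'M[R]_n) :
  tensor_form (tensor_conj V T) H = tensor_form T (fun r => V^T *m H r *m V).
Proof.
rewrite /tensor_form; under eq_bigr do rewrite ffunE mulr_suml.
rewrite exchange_big; apply: eq_bigr => q _ /=.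
under eq_bigr do rewrite -mulrA; rewrite -mulr_sumr; congr (_ * _).
pose f (u l : {ffun 'I_k -> 'I_n}) :=
  \prod_(r < k) (V (u r) (upper q r) * H r (u r) (l r) * V (l r) (lower q r)).
transitivity (\sum_(p : {ffun 'I_(k + k) -> 'I_n}) f (upper p) (lower p)).
  apply: eq_bigr => p _; rewrite /f big_split_ord /= mulrAC -!big_split /=.
  by apply: eq_bigr => r _; rewrite !ffunE.
rewrite sum_upper_lower /f.
transitivity (\prod_(r < k) \sum_a \sum_b
    V a (upper q r) * H r a b * V b (lower q r)).
  rewrite bigA_distr_bigA; apply: eq_bigr => u _.
  by rewrite bigA_distr_bigA.
apply: eq_bigr => r _; rewrite mxE exchange_big /=; apply: eq_bigr => b _.
rewrite mxE mulr_suml; apply: eq_bigr => a _.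
by rewrite mxE.
Qed.

(** For given upper indices, a single choice of the lower ones contributes. *)
Lemma tensor_form_Diag k (s : 'S_k) (T : tensor R n k) (H : 'I_k -> 'M[R]_n) :
  tensor_form (Diag s T) H = \sum_u T u * \prod_r H r (u r) (u ((s^-1)%g r)).
Proof.
pose f (u l : {ffun 'I_k -> 'I_n}) :=
  (if [forall r, u r == l (s r)] then T u else 0) * \prod_r H r (u r) (l r).
transitivity (\sum_(p : {ffun 'I_(k + k) -> 'I_n}) f (upper p) (lower p)).
  by apply: eq_bigr => p _; rewrite /f ffunE.
rewrite sum_upper_lower; apply: eq_bigr => u _.
pose l0 : {ffun 'I_k -> 'I_n} := [ffun r => u ((s^-1)%g r)].
rewrite (bigD1 l0) //= big1 ?addr0 => [|l ll0]; last first.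
  rewrite /f ifN ?mul0r //; apply: contraNN ll0 => /forallP H0.
  by apply/eqP/ffunP => r; rewrite ffunE; have /eqP -> := H0 ((s^-1)%g r); rewrite permKV.
rewrite /f; have -> : [forall r, u r == l0 (s r)].
  by apply/forallP => r; rewrite ffunE permK.
by congr (_ * _); apply: eq_bigr => r _; rewrite ffunE.
Qed.

Lemma tensor_form_sum k (J : finType) (P : pred J) (T : J -> tensor R n (k + k)) H :
  tensor_form (\sum_(t | P t) T t) H = \sum_(t | P t) tensor_form (T t) H.
Proof.
rewrite /tensor_form exchange_big; apply: eq_bigr => p _.
by rewrite sum_ffunE mulr_suml.
Qed.

(** Symmetric matrices are orthogonal to the antisymmetric part. *)
Lemma mxtrace_sympart (M : 'M[R]_n) (K : sym R n) :
  \tr (symval (sympart M) *m (symval K)^T) = \tr (M *m symval K).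
Proof.
have KT : (symval K)^T = symval K by apply/eqP; case: K.
rewrite KT /= -scalemxAl mulmxDl mxtraceZ mxtraceD.
have -> : \tr (M^T *m symval K) = \tr (M *m symval K).
  by rewrite -mxtrace_tr trmx_mul trmxK KT mxtrace_mulC.
by field.
Qed.

(** Renaming the indices along the orbit of the last point turns the contraction
over a cycle into the trace of a word; the divided difference is unaffected,
being symmetric. *)
Lemma sum_cycle_relabel F mu k (p : 'S_k) (B : 'I_k.+1 -> 'M[R]_n) :
  \sum_(u : {ffun 'I_k.+1 -> 'I_n}) dd F [seq mu 0 (u r) | r <- enum 'I_k.+1] *
    \prod_r B r (u r) (u ((cycle_of p)^-1%g r)) =
  \tr (word_mx F mu [seq B (lift ord_max (p i)) | i <- enum 'I_k] *m B ord_max).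
Proof.
pose q := fix_last p.
have -> : [seq B (lift ord_max (p i)) | i <- enum 'I_k] =
    [seq (B \o q) (lift ord_max i) | i <- enum 'I_k].
  by apply: eq_map => i /=; rewrite /q /fix_last lift_perm_lift.
have -> : B ord_max = (B \o q) ord_max by rewrite /= /q /fix_last lift_perm_id.
rewrite trace_word.
pose h (v : {ffun 'I_k.+1 -> 'I_n}) : {ffun 'I_k.+1 -> 'I_n} := [ffun r => v ((q^-1)%g r)].
rewrite (reindex h) /=; last first.
  exists (fun v : {ffun 'I_k.+1 -> 'I_n} => [ffun r => v (q r)]) => v _.
    by apply/ffunP => r; rewrite !ffunE permK.
  by apply/ffunP => r; rewrite !ffunE permKV.
apply: eq_bigr => v _; congr (_ * _).
  apply: dd_perm; rewrite (eq_map (g := (mu 0 \o v) \o (q^-1)%g)); last first.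
    by move=> r; rewrite /= ffunE.
  rewrite map_comp; apply: perm_map; apply: uniq_perm; rewrite ?enum_uniq //.
    by rewrite map_inj_uniq ?enum_uniq //; exact: perm_inj.
  move=> r; rewrite mem_enum; apply/mapP; exists (q r); rewrite ?mem_enum //.
  by rewrite permK.
rewrite (reindex_inj (@perm_inj _ q)) /=; apply: eq_bigr => r _.
by rewrite !ffunE permK cycle_ofVE permK.
Qed.

End TraceFormula.

(** The cycles of [k.+2] points and the orderings of [k.+1] directions correspond
term by term. *)
Lemma nabla_tensor_formula (R : realType) (k n : nat) (I : set R) (g : R -> R)
    (X : sym R n) (V : 'M[R]_n) (H : 'I_k.+1 -> sym R n) (K : sym R n) :
  is_interval I -> I° !=set0 -> (forall i, I (lambda X 0 i)) ->
  is_diagonalizer X V -> times_differentiable_on I k.+1 g ->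
  \tr (symval (nabla (fun i => iter i (derive_on I) g) X H) *m (symval K)^T) =
  tensor_form
    (tensor_conj V
      (\sum_(t : 'S_k.+2 | one_cycle t)
         Diag t (div_diff_tensor I g t (lambda X))))
    (fun r => symval (snoc H K r)).
Proof.
move=> hI hI0 DX XV /times_differentiable_tower tF.
rewrite tensor_form_conj tensor_form_sum sum_one_cycle.
rewrite mxtrace_sympart mulmx_suml raddf_sum /=; apply: eq_bigr => p _.
set B := fun r => V^T *m _ *m V.
rewrite tensor_form_Diag.
transitivity (\sum_(u : {ffun 'I_k.+2 -> 'I_n})
    dd (fun i => iter i (derive_on I) g) [seq lambda X 0 (u r) | r <- enum 'I_k.+2] *
    \prod_r B r (u r) (u ((cycle_of p)^-1%g r))); last first.
  apply: eq_bigr => u _; congr (_ * _); rewrite ffunE.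
  by rewrite div_diff_dd //; exact: cycle_of_one_cycle.
rewrite sum_cycle_relabel (nabla_word_any _ _ XV) /conj_word.
rewrite -!mulmxA mxtrace_mulC /B snoc_max -!mulmxA.
have -> : [seq V^T *m A *m V | A <- perm_seq H p] =
    [seq V^T *m symval (snoc H K (lift ord_max (p i))) *m V | i <- enum 'I_k.+1].
  by rewrite /perm_seq -map_comp; apply: eq_map => i /=; rewrite snoc_lift.
by [].
Qed.

Theorem theorem6p1 (R : realType) (k n : nat) (I : set R) (g : R -> R)
    (X : sym R n) (V : 'M[R]_n)
    (hI : is_interval I) (hI0 : I° !=set0)
    (hX : forall i, I (lambda X 0 i))
    (hV : orthogonal_mx V)
    (hXV : symval X = V *m diag_mx (lambda X) *m V^T) :
  let D := @spectral_dom R n I in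
  let G := @spectral_fun R n g in
  let nablaG_formula :=
    exists L : ('I_k.+1 -> sym R n) -> sym R n,
      is_nabla D G X L /\
      forall (H : 'I_k.+1 -> sym R n) (K : sym R n),
        \tr (symval (L H) *m (symval K)^T) =
        tensor_form
          (tensor_conj V
            (\sum_(t : 'S_k.+2 | one_cycle t)
               Diag t (div_diff_tensor I g t (lambda X))))
          (fun r => symval (snoc H K r)) in
  (times_differentiable_on I k.+1 g ->
     times_differentiable_at D k.+1 G X /\ nablaG_formula) /\
  (times_cont_differentiable_on I k.+1 g ->
     times_cont_differentiable_at D k.+1 G X /\ nablaG_formula).
Proof.
move=> D G nablaG_formula.
pose F i := iter i (derive_on I) g.
have nablaP Y : times_differentiable_on I k.+1 g -> D Y ->
    is_nabla D G Y (nabla F Y (k := k.+1)).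
  move=> /times_differentiable_tower tF DY; exact: (nabla_is_nabla hI DY tF).
have formula : times_differentiable_on I k.+1 g -> nablaG_formula.
  move=> hg; exists (nabla F X (k := k.+1)); split; first exact: nablaP.
  by move=> H K; exact: nabla_tensor_formula.
split=> [hg|[hg cg]]; split; try exact: formula.
  by exists (nabla F X (k := k.+1)); exact: nablaP.
exists (fun Y => nabla F Y (k := k.+1)).
apply: (@filterE _ (nbhs X)) => Y DY; split; first exact: nablaP.
apply: nabla_continuous => //; first exact: times_differentiable_tower.
move=> a Ia q q0.
have /subspace_continuousP/(_ a Ia)/cvgrPdist_le/(_ q q0) := cg.
move=> cFa; have {}cFa : \forall x \near a, I x -> `|F k.+1 a - F k.+1 x| <= q.
  exact: cFa.
by apply: filterS cFa => x Hx Ix; rewrite distrC; exact: Hx.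
Qed.
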